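(* The system $\mathsf{WKL}_0^\omega+\mathsf{QF\text{-}AC}^{2,0}$ proves $(\kappa_0^3)\leftrightarrow\big[(Z^3)\wedge\mathsf{FF}\big]$.
   Context: Work in the language $\mathsf{L}_\omega$ of higher-order arithmetic with variables of all finite types: $0$ is the type of natural numbers and $\sigma\to\tau$ the type of mappings from type-$\sigma$ objects to type-$\tau$ objects; $1=0\to0$, $2=1\to0$, $3=2\to0$. Equality at higher types is pointwise: $x=_\tau y$ iff $x z_1\dots z_k=_0 y z_1\dots z_k$ for all arguments; $\le_\tau$ is defined likewise using $\le_0$. $\mathsf{RCA}_0^\omega$ is Kohlenbach's base theory: basic axioms making $0,1,<,+,\times$ an ordered semiring with equality, the combinators $K,S$ (giving $\lambda$-abstraction), the recursor $\mathbf{R}_0$ with $\mathbf{R}_0(f,m,0)=m$, $\mathbf{R}_0(f,m,n+1)=f(\mathbf{R}_0(f,m,n))$, extensionality at all types, induction for quantifier-free formulas, and $\mathsf{QF\text{-}AC}^{1,0}$. For types $\sigma,\tau$, $\mathsf{QF\text{-}AC}^{\sigma,\tau}$ is the schema $(\forall x^\sigma)(\exists y^\tau)A(x,y)\to(\exists Y^{\sigma\to\tau})(\forall x^\sigma)A(x,Y(x))$ for quantifier-free $A$. $\mathsf{WKL}$ is the statement ''every infinite binary tree has a path'' and $\mathsf{WKL}_0^\omega=\mathsf{RCA}_0^\omega+\mathsf{WKL}$. For $f^1$ and $n^0$, $\overline{f}n$ denotes the finite sequence $\langle f(0),\dots,f(n-1)\rangle$; $C$ (Cantor space) is the set of $f^1\le_1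 1$. $(\kappa_0^3)$: $(\exists \kappa_0^3)(\forall Y^2)\big[\kappa_0(Y)=0\leftrightarrow(\exists f\in C)(Y(f)>0)\big]$. $(Z^3)$: $(\exists Z^3)(\forall Y^2)\big[Z(Y)=0\leftrightarrow(\forall f^1)(\exists N^0)(\forall g^1)(\overline fN=\overline gN\to Y(f)=Y(g))\big]$. $\mathsf{FF}$: $(\exists\Phi^3)(\forall Y^2\in\mathsf{cont})(\forall f,g\in C)(\overline f\Phi(Y)=\overline g\Phi(Y)\to Y(f)=Y(g))$, where $Y^2\in\mathsf{cont}$ means $Y$ is continuous on Baire space, i.e. $(\forall f^1)(\exists N^0)(\forall g^1)(\overline fN=\overline gN\to Y(f)=Y(g))$. *)

(* Defs.v *)
From Stdlib Require Import List.

Set Implicit Arguments.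
Unset Strict Implicit.
Unset Printing Implicit Defensive.

Declare Scope ho_scope.
Delimit Scope ho_scope with ho.

(** Terms and formulas of L_omega are intrinsically typed; variables are de
    Bruijn indices into a context listing the types of the free variables. *)

Inductive ty : Type :=
| N0 : ty
| Arr : ty -> ty -> ty.

Notation "s ~> t" := (Arr s t) (at level 61, right associativity) : ho_scope.
Local Open Scope ho_scope.

Notation ty1 := (N0 ~> N0).
Notation ty2 := (ty1 ~> N0).
Notation ty3 := (ty2 ~> N0).

Definition ctx := list ty.

Inductive var : ctx -> ty -> Type :=
| vz : forall (G : ctx) (s : ty), var (s :: G) s
| vs : forall (G : ctx) (s t : ty), var G s -> var (t :: G) s.

Arguments vz {G s}.
Arguments vs {G s t} _.

Inductive term (G : ctx) : ty -> Type :=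
| Var : forall s, var G s -> term G s
| App : forall s t, term G (s ~> t) -> term G s -> term G t
| Zero : term G N0
| One : term G N0
| Plus : term G (N0 ~> N0 ~> N0)
| Times : term G (N0 ~> N0 ~> N0)
| CombK : forall s t, term G (s ~> t ~> s)
| CombS : forall r s t, term G ((r ~> s ~> t) ~> (r ~> s) ~> r ~> t)
| Rec0 : term G (ty1 ~> N0 ~> N0 ~> N0).

Arguments Var {G s} _.
Arguments App {G s t} _ _.
Arguments Zero {G}.
Arguments One {G}.
Arguments Plus {G}.
Arguments Times {G}.
Arguments CombK {G} s t.
Arguments CombS {G} r s t.
Arguments Rec0 {G}.

(** Only equality and order at type 0 are primitive. *)
Inductive form : ctx -> Type :=
| Eq0 : forall G, term G N0 -> term G N0 -> form G
| Lt0 : forall G, term G N0 -> term G N0 -> form G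
| Bot : forall G, form G
| Imp : forall G, form G -> form G -> form G
| And : forall G, form G -> form G -> form G
| Or : forall G, form G -> form G -> form G
| All : forall G (s : ty), form (s :: G) -> form G
| Ex : forall G (s : ty), form (s :: G) -> form G.

Arguments Bot {G}.
Arguments All {G} s _.
Arguments Ex {G} s _.

Notation "f @ x" := (App f x) (at level 39, left associativity) : ho_scope.
Notation "x [+] y" := (App (App Plus x) y)
  (at level 50, left associativity) : ho_scope.
Notation "x [*] y" := (App (App Times x) y)
  (at level 40, left associativity) : ho_scope.
Notation "x == y" := (Eq0 x y) (at level 70) : ho_scope.
Notation "x << y" := (Lt0 x y) (at level 70) : ho_scope.
Notation "x <<= y" := (Or (Lt0 x y) (Eq0 x y)) (at level 70) : ho_scope.
Notation "A [&] B" := (And A B) (at level 80, right associativity) : ho_scope.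
Notation "A [|] B" := (Or A B) (at level 85, right associativity) : ho_scope.
Notation "A ==> B" := (Imp A B) (at level 90, right associativity) : ho_scope.
Notation "A <==> B" := (And (Imp A B) (Imp B A)) (at level 92) : ho_scope.

Notation "#0" := (Var vz) : ho_scope.
Notation "#1" := (Var (vs vz)) : ho_scope.
Notation "#2" := (Var (vs (vs vz))) : ho_scope.
Notation "#3" := (Var (vs (vs (vs vz)))) : ho_scope.

Fixpoint qfree (G : ctx) (A : form G) : Prop :=
  match A with
  | Eq0 _ _ | Lt0 _ _ | Bot => True
  | Imp A B | And A B | Or A B => qfree A /\ qfree B
  | All _ _ | Ex _ _ => False
  end.

Definition ren (G D : ctx) := forall s, var G s -> var D s.
Definition sub (G D : ctx) := forall s, var G s -> term D s.

Fixpoint rename (G D : ctx) (r : ren G D) (s : ty) (t : term G s) : term D s :=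
  match t with
  | Var x => Var (r _ x)
  | App f u => App (rename r f) (rename r u)
  | Zero => Zero
  | One => One
  | Plus => Plus
  | Times => Times
  | CombK s t => CombK s t
  | CombS q s t => CombS q s t
  | Rec0 => Rec0
  end.

Definition wk (G : ctx) (u s : ty) (t : term G s) : term (u :: G) s :=
  rename (fun _ x => vs x) t.
Arguments wk {G u s} t.

Fixpoint tsubst (G D : ctx) (f : sub G D) (s : ty) (t : term G s) : term D s :=
  match t with
  | Var x => f _ x
  | App g u => App (tsubst f g) (tsubst f u)
  | Zero => Zero
  | One => One
  | Plus => Plus
  | Times => Times
  | CombK s t => CombK s t
  | CombS q s t => CombS q s t
  | Rec0 => Rec0
  end.

(** [scons t f] sends index 0 to [t] and the other indices along [f]. *)
Definition scons (G D : ctx) (u : ty) (t : term D u) (f : sub G D) :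
    sub (u :: G) D :=
  fun s x =>
    match x in var G' s' return
      match G' with
      | nil => unit
      | u' :: G'' => term D u' -> sub G'' D -> term D s'
      end
    with
    | vz => fun t _ => t
    | vs y => fun _ f => f _ y
    end t f.

Definition up (G D : ctx) (u : ty) (f : sub G D) : sub (u :: G) (u :: D) :=
  scons (Var vz) (fun _ x => wk (f _ x)).

Fixpoint fsubst (G : ctx) (A : form G) : forall D, sub G D -> form D :=
  match A in form G return forall D, sub G D -> form D with
  | Eq0 t u => fun D f => Eq0 (tsubst f t) (tsubst f u)
  | Lt0 t u => fun D f => Lt0 (tsubst f t) (tsubst f u)
  | Bot => fun D f => Bot
  | Imp A B => fun D f => Imp (fsubst A f) (fsubst B f)
  | And A B => fun D f => And (fsubst A f) (fsubst B f)
  | Or A B => fun D f => Or (fsubst A f) (fsubst B f)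
  | All s A => fun D f => All s (fsubst A (up f))
  | Ex s A => fun D f => Ex s (fsubst A (up f))
  end.

Definition fwk (G : ctx) (u : ty) (A : form G) : form (u :: G) :=
  fsubst A (fun _ x => Var (vs x)).
Arguments fwk {G} u A.

Definition inst (G : ctx) (u : ty) (A : form (u :: G)) (t : term G u) : form G :=
  fsubst A (scons t (fun _ x => Var x)).

(** A theory is given by its axioms, which may contain free variables
    (parameters); these are read universally. *)

Definition theory := forall G : ctx, form G -> Prop.

Inductive prov (T : theory) : forall G : ctx, list (form G) -> form G -> Prop :=
| p_ax : forall G (H : list (form G)) A, T G A -> prov T H A
| p_hyp : forall G (H : list (form G)) A, In A H -> prov T H A
| p_raa : forall G (H : list (form G)) A,
    prov T ((A ==> Bot) :: H) Bot -> prov T H A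
| p_impI : forall G (H : list (form G)) A B,
    prov T (A :: H) B -> prov T H (A ==> B)
| p_impE : forall G (H : list (form G)) A B,
    prov T H (A ==> B) -> prov T H A -> prov T H B
| p_andI : forall G (H : list (form G)) A B,
    prov T H A -> prov T H B -> prov T H (A [&] B)
| p_andE1 : forall G (H : list (form G)) A B,
    prov T H (A [&] B) -> prov T H A
| p_andE2 : forall G (H : list (form G)) A B,
    prov T H (A [&] B) -> prov T H B
| p_orI1 : forall G (H : list (form G)) A B,
    prov T H A -> prov T H (A [|] B)
| p_orI2 : forall G (H : list (form G)) A B,
    prov T H B -> prov T H (A [|] B)
| p_orE : forall G (H : list (form G)) A B C,
    prov T H (A [|] B) -> prov T (A :: H) C -> prov T (B :: H) C -> prov T H C
| p_allI : forall G (H : list (form G)) s (A : form (s :: G)),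
    prov T (map (fwk s) H) A -> prov T H (All s A)
| p_allE : forall G (H : list (form G)) s (A : form (s :: G)) (t : term G s),
    prov T H (All s A) -> prov T H (inst A t)
| p_exI : forall G (H : list (form G)) s (A : form (s :: G)) (t : term G s),
    prov T H (inst A t) -> prov T H (Ex s A)
| p_exE : forall G (H : list (form G)) s (A : form (s :: G)) (B : form G),
    prov T H (Ex s A) -> prov T (A :: map (fwk s) H) (fwk s B) -> prov T H B.

Definition proves (T : theory) (A : form nil) : Prop := prov T nil A.

Notation "T |-- A" := (proves T A) (at level 95, no associativity) : ho_scope.

Fixpoint eq_at (s : ty) : forall G, term G s -> term G s -> form G :=
  match s return forall G, term G s -> term G s -> form G with
  | N0 => fun G x y => x == y
  | Arr s t => fun G x y => All s (eq_at (wk x @ #0) (wk y @ #0))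
  end.

Fixpoint le_at (s : ty) : forall G, term G s -> term G s -> form G :=
  match s return forall G, term G s -> term G s -> form G with
  | N0 => fun G x y => x <<= y
  | Arr s t => fun G x y => All s (le_at (wk x @ #0) (wk y @ #0))
  end.

(** For [A] with variable 1 of type [s] and variable 0 of type [t], the
    matrix [A (x, Y x)], in which variable 1 is [Y] and variable 0 is [x]. *)
Definition choice_matrix (G : ctx) (s t : ty) (A : form (t :: s :: G)) :
    form (s :: (s ~> t) :: G) :=
  fsubst A (scons (#1 @ #0) (scons #0 (fun _ x => Var (vs (vs x))))).

Inductive QF_AC (s t : ty) : theory :=
| qf_ac : forall G (A : form (t :: s :: G)), qfree A ->
    @QF_AC s t G
      (All s (Ex t A) ==> Ex (s ~> t) (All s (choice_matrix A))).

(** The arithmetical axioms, [ax_addA] to [ax_nonneg], are those of PA^-, the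
    theory of discretely ordered semirings.  Congruence of [Plus], [Times] and
    of application with respect to equality is an instance of [ax_ext]. *)
Inductive RCA0w (G : ctx) : form G -> Prop :=
| ax_refl : forall x : term G N0, RCA0w (x == x)
| ax_sym : forall x y : term G N0, RCA0w (x == y ==> y == x)
| ax_trans : forall x y z : term G N0, RCA0w (x == y ==> y == z ==> x == z)
| ax_lt_eq : forall x x' y y' : term G N0,
    RCA0w (x == x' ==> y == y' ==> x << y ==> x' << y')
| ax_addA : forall x y z : term G N0, RCA0w ((x [+] y) [+] z == x [+] (y [+] z))
| ax_addC : forall x y : term G N0, RCA0w (x [+] y == y [+] x)
| ax_add0 : forall x : term G N0, RCA0w (x [+] Zero == x)
| ax_mulA : forall x y z : term G N0, RCA0w ((x [*] y) [*] z == x [*] (y [*] z))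
| ax_mulC : forall x y : term G N0, RCA0w (x [*] y == y [*] x)
| ax_mul0 : forall x : term G N0, RCA0w (x [*] Zero == Zero)
| ax_mul1 : forall x : term G N0, RCA0w (x [*] One == x)
| ax_mulD : forall x y z : term G N0,
    RCA0w (x [*] (y [+] z) == (x [*] y) [+] (x [*] z))
| ax_lt_irr : forall x : term G N0, RCA0w (x << x ==> Bot)
| ax_lt_trans : forall x y z : term G N0, RCA0w (x << y ==> y << z ==> x << z)
| ax_lt_total : forall x y : term G N0, RCA0w (x << y [|] x == y [|] y << x)
| ax_lt_add : forall x y z : term G N0, RCA0w (x << y ==> x [+] z << y [+] z)
| ax_lt_mul : forall x y z : term G N0,
    RCA0w (Zero << z ==> x << y ==> x [*] z << y [*] z)
| ax_lt_diff : forall x y : term G N0,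
    RCA0w (x << y ==> Ex N0 (wk x [+] #0 == wk y))
| ax_lt01 : RCA0w (Zero << One)
| ax_discrete : forall x : term G N0, RCA0w (Zero << x ==> One <<= x)
| ax_nonneg : forall x : term G N0, RCA0w (Zero <<= x)
| ax_K : forall s t (x : term G s) (y : term G t),
    RCA0w (eq_at (CombK s t @ x @ y) x)
| ax_S : forall r s t (x : term G (r ~> s ~> t)) (y : term G (r ~> s))
      (z : term G r),
    RCA0w (eq_at (CombS r s t @ x @ y @ z) (x @ z @ (y @ z)))
| ax_R0 : forall (f : term G ty1) (m : term G N0),
    RCA0w (Rec0 @ f @ m @ Zero == m)
| ax_RS : forall (f : term G ty1) (m n : term G N0),
    RCA0w (Rec0 @ f @ m @ (n [+] One) == f @ (Rec0 @ f @ m @ n))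
| ax_ext : forall s t (x y : term G s) (F : term G (s ~> t)),
    RCA0w (eq_at x y ==> eq_at (F @ x) (F @ y))
| ax_ind : forall A : form (N0 :: G), qfree A ->
    RCA0w (inst A Zero
           ==> All N0 (A ==> fsubst A (scons (#0 [+] One) (fun _ x => Var (vs x))))
           ==> All N0 A)
| ax_ac : forall A : form G, QF_AC ty1 N0 A -> RCA0w A.

Definition in_cantor (G : ctx) (f : term G ty1) : form G :=
  le_at f (CombK N0 N0 @ One).

(** Equality of the finite sequences [<f 0, .., f (n-1)>], [<g 0, .., g (n-1)>]
    of the same length [n]. *)
Definition bar_eq (G : ctx) (f g : term G ty1) (n : term G N0) : form G :=
  All N0 (#0 << wk n ==> wk f @ #0 == wk g @ #0).

(** Coding of finite sequences by numbers: the empty sequence has code 0, and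
    if [c] is the code of [u], then [u] extended by [a] has code
    [(c + a)^2 + c + 1]; this is injective in [(c, a)]. *)
Definition snoc_code (G : ctx) (c a : term G N0) : term G N0 :=
  (c [+] a) [*] (c [+] a) [+] c [+] One.

(** [c] is the code of [<f 0, .., f (n-1)>]; the witness [h] lists the codes
    of the initial segments. *)
Definition bar_code (G : ctx) (f : term G ty1) (n c : term G N0) : form G :=
  Ex ty1 (#0 @ Zero == Zero
      [&] All N0 (#0 << wk (wk n) ==>
            #1 @ (#0 [+] One) == snoc_code (#1 @ #0) (wk (wk f) @ #0))
      [&] #0 @ wk n == wk c).

(** Sets of numbers are given by functions of type 1, membership being value 0. *)
Definition mem (G : ctx) (c : term G N0) (X : term G ty1) : form G :=
  X @ c == Zero.

Definition bar_mem (G : ctx) (f : term G ty1) (n : term G N0) (T : term G ty1) :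
    form G :=
  Ex N0 (bar_code (wk f) (wk n) #0 [&] mem #0 (wk T)).

(** Every element codes a finite binary sequence, and the set is closed under
    initial segments; finite binary sequences are presented as initial segments
    of elements of Cantor space. *)
Definition binary_tree (G : ctx) (T : term G ty1) : form G :=
  All N0 (mem #0 (wk T) ==>
    Ex ty1 (in_cantor #0 [&] Ex N0 (bar_code #1 #0 #2)))
  [&]
  All ty1 (in_cantor #0 ==>
    All N0 (All N0 (#0 <<= #1 ==>
      bar_mem #2 #1 (wk (wk (wk T))) ==> bar_mem #2 #0 (wk (wk (wk T)))))).

Definition infinite_set (G : ctx) (X : term G ty1) : form G :=
  All N0 (Ex N0 (#1 << #0 [&] mem #0 (wk (wk X)))).

Definition has_path (G : ctx) (T : term G ty1) : form G :=
  Ex ty1 (in_cantor #0 [&] All N0 (bar_mem #1 #0 (wk (wk T)))).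

Inductive WKL : theory :=
| wkl : forall G : ctx,
    @WKL G (All ty1 (binary_tree #0 ==> infinite_set #0 ==> has_path #0)).

Definition theory_union (T U : theory) : theory := fun G A => T G A \/ U G A.
Notation "T [U] U" := (theory_union T U)
  (at level 60, right associativity) : ho_scope.

Definition WKL0w : theory := RCA0w [U] WKL.

Definition kappa03 : form nil :=
  Ex ty3 (All ty2 (
    #1 @ #0 == Zero <==> Ex ty1 (in_cantor #0 [&] Zero << #1 @ #0))).

Definition cont (G : ctx) (Y : term G ty2) : form G :=
  All ty1 (Ex N0 (All ty1 (
    bar_eq #2 #0 #1 ==> wk (wk (wk Y)) @ #2 == wk (wk (wk Y)) @ #0))).

Definition Z3 : form nil :=
  Ex ty3 (All ty2 (#1 @ #0 == Zero <==> cont #0)).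

(** In the matrix, variables 3, 2, 1, 0 are [Phi], [Y], [f], [g]. *)
Definition FF : form nil :=
  Ex ty3 (All ty2 (cont #0 ==>
    All ty1 (in_cantor #0 ==> All ty1 (in_cantor #0 ==>
      bar_eq #1 #0 (#3 @ #2) ==> #2 @ #1 == #2 @ #0)))).

(* Main.v *)
(** By Goedel's completeness theorem (a Henkin construction, followed by a quotient
    by pointwise equality) it suffices to argue in an arbitrary extensional model.
    Call E2 the existence of a functional deciding [exists n, f n = 0].  By
    Grilliot's trick, if E2 fails then every [Y^2] is continuous on Baire space.

    From kappa to Z: under E2, quantifiers over numbers, Cantor space and hence
    Baire space are decidable, so continuity is; without E2, [Z] is constant.  From
    kappa and Z to FF: kappa decides whether [n] is a modulus of uniform continuity
    of [Y] on Cantor space, WKL provides one for continuous [Y], and QF-AC^{2,0}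
    selects it.  Conversely, under E2 there is a functional built from [Y] which is
    continuous iff [Y] vanishes on Cantor space; without E2, the modulus [Phi Y]
    bounds the search for [f] in Cantor space with [Y f > 0]. *)

Require Import Defs.
From Stdlib Require Import List Arith Lia Cantor Ring Eqdep_dec.
From Stdlib Require Import FunctionalExtensionality PropExtensionality ProofIrrelevance ClassicalEpsilon.
Import ListNotations.
Set Implicit Arguments.
Unset Strict Implicit.
Unset Printing Implicit Defensive.
Local Open Scope ho_scope.

(** * Substitution *)

(** Two restrictions shape the development. First, witnesses cannot be fresh constants, because the
    signature is fixed and terms are intrinsically typed. Free variables serve instead, so formulas
    live in growing contexts and an element of the term model is a coherent family of terms over
    these contexts. Second, the numbers of a model may be nonstandard, so induction and choice hold
    only for predicates with a characteristic functional in the model. [rep] and [dec] keep track of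
    these, and bounds are inserted wherever a quantifier would otherwise leave this class.

    The split on E2 bridges two mismatches: kappa quantifies over Cantor space while continuity
    speaks of Baire space, and the fan functional says something about continuous arguments only.
    With E2, functions are coded by their graphs in Cantor space; without it, every argument is
    continuous. *)

Definition vcase (G : ctx) (u : ty) (P : forall s, var (u :: G) s -> Type)
    (Pz : P u vz) (Ps : forall s (x : var G s), P s (vs x)) :
    forall s (x : var (u :: G) s), P s x :=
  fun s x =>
    match x as x0 in var G0 s0 return
      match G0 return var G0 s0 -> Type with
      | nil => fun _ => unit
      | u0 :: G1 => fun x0 => forall (P : forall s, var (u0 :: G1) s -> Type),
          P u0 vz -> (forall s (y : var G1 s), P s (vs y)) -> P s0 x0
      end x0
    with
    | vz => fun P Pz _ => Pz
    | vs y => fun P _ Ps => Ps _ y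
    end P Pz Ps.

Lemma no_var (P : forall s, var nil s -> Prop) : forall s (x : var nil s), P s x.
Proof.
refine (fun s x => match x as x0 in var G0 s0 return
  match G0 return var G0 s0 -> Prop with
  | nil => fun x0 => forall P : (forall s, var nil s -> Prop), P s0 x0
  | _ => fun _ => True end x0 with vz => I | vs _ => I end P).
Qed.

(** [R] is arbitrary, so this serves substitutions, environments of threads and environments in a
    model. *)
Lemma sub_ext (G : ctx) (R : ty -> Type) (f g : forall s, var G s -> R s) :
  (forall s (x : var G s), f s x = g s x) -> f = g.
Proof.
intros H; apply functional_extensionality_dep; intros s.
apply functional_extensionality; apply H.
Qed.

Definition tvs (G : ctx) (u : ty) : sub G (u :: G) := fun _ x => Var (vs x).
Arguments tvs {G u} s x.

Lemma tsubst_id (G : ctx) s (t : term G s) : tsubst (fun _ x => Var x) t = t.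
Proof. induction t; simpl; congruence. Qed.

Lemma up_id (G : ctx) u : up (fun s (x : var G s) => Var x) = fun s (x : var (u :: G) s) => Var x.
Proof. apply sub_ext; apply vcase; reflexivity. Qed.

Lemma fsubst_id (G : ctx) (A : form G) : fsubst A (fun _ x => Var x) = A.
Proof. induction A; simpl; rewrite ?tsubst_id, ?up_id; congruence. Qed.

Lemma rename_tsubst (G D : ctx) (r : ren G D) s (t : term G s) :
  rename r t = tsubst (fun s x => Var (r s x)) t.
Proof. induction t; simpl; congruence. Qed.

Lemma tsubst_rename (G D E : ctx) (r : ren G D) (f : sub D E) s (t : term G s) :
  tsubst f (rename r t) = tsubst (fun s x => f s (r s x)) t.
Proof. induction t; simpl; congruence. Qed.

Lemma rename_rename (G D E : ctx) (r : ren G D) (q : ren D E) s (t : term G s) :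
  rename q (rename r t) = rename (fun s x => q s (r s x)) t.
Proof. induction t; simpl; congruence. Qed.

Lemma rename_of_tsubst (G D E : ctx) (f : sub G D) (q : ren D E) s (t : term G s) :
  rename q (tsubst f t) = tsubst (fun s x => rename q (f s x)) t.
Proof. induction t; simpl; congruence. Qed.

Lemma tsubst_wk (G D : ctx) u (f : sub (u :: G) D) s (t : term G s) :
  tsubst f (wk t) = tsubst (fun s x => f s (vs x)) t.
Proof. apply tsubst_rename. Qed.

Lemma tsubst_up_wk (G D : ctx) u (f : sub G D) s (t : term G s) :
  tsubst (up (u:=u) f) (wk t) = wk (tsubst f t).
Proof. unfold wk; rewrite tsubst_rename, rename_of_tsubst; reflexivity. Qed.

Lemma tsubst_tvs (G : ctx) u s (t : term G s) : tsubst (tvs (u:=u)) t = wk t.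
Proof. unfold wk; rewrite rename_tsubst; reflexivity. Qed.

Lemma tsubst_tsubst (G D E : ctx) (f : sub G D) (g : sub D E) s (t : term G s) :
  tsubst g (tsubst f t) = tsubst (fun s x => tsubst g (f s x)) t.
Proof. induction t; simpl; congruence. Qed.

Lemma up_comp (G D E : ctx) u (f : sub G D) (g : sub D E) :
  (fun s x => tsubst (up (u:=u) g) (up f x)) = up (fun s x => tsubst g (f s x)).
Proof.
apply sub_ext; apply vcase; [reflexivity|].
intros s x; simpl; apply tsubst_up_wk.
Qed.

Lemma fsubst_fsubst (G D E : ctx) (A : form G) (f : sub G D) (g : sub D E) :
  fsubst (fsubst A f) g = fsubst A (fun s x => tsubst g (f s x)).
Proof.
revert D E f g; induction A; intros D E f g; simpl;
  rewrite ?tsubst_tsubst, ?IHA, ?IHA1, ?IHA2, ?up_comp; reflexivity.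
Qed.

Lemma fsubst_fwk (G D : ctx) u (f : sub (u :: G) D) (A : form G) :
  fsubst (fwk u A) f = fsubst A (fun s x => f s (vs x)).
Proof. unfold fwk; rewrite fsubst_fsubst; reflexivity. Qed.

Lemma fwk_fsubst (G D : ctx) u (f : sub G D) (A : form G) :
  fwk u (fsubst A f) = fsubst A (fun s x => wk (f s x)).
Proof.
unfold fwk; rewrite fsubst_fsubst; f_equal; apply sub_ext; intros; apply tsubst_tvs.
Qed.

Lemma fsubst_up_fwk (G D : ctx) u (f : sub G D) (A : form G) :
  fsubst (fwk u A) (up f) = fwk u (fsubst A f).
Proof. rewrite fsubst_fwk, fwk_fsubst; reflexivity. Qed.

Lemma inst_up (G D : ctx) u (f : sub G D) (A : form (u :: G)) (t : term D u) :
  inst (fsubst A (up f)) t = fsubst A (scons t f).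
Proof.
unfold inst; rewrite fsubst_fsubst; f_equal; apply sub_ext; apply vcase; [reflexivity|].
intros s x; simpl; rewrite tsubst_wk; apply tsubst_id.
Qed.

Lemma fsubst_inst (G D : ctx) u (f : sub G D) (A : form (u :: G)) (t : term G u) :
  fsubst (inst A t) f = inst (fsubst A (up f)) (tsubst f t).
Proof.
rewrite inst_up; unfold inst; rewrite fsubst_fsubst; f_equal.
apply sub_ext; apply vcase; reflexivity.
Qed.

Lemma inst_vz (G : ctx) u (A : form (u :: G)) : inst (fsubst A (up (tvs (u:=u)))) #0 = A.
Proof.
rewrite inst_up; transitivity (fsubst A (fun _ x => Var x)); [|apply fsubst_id].
f_equal; apply sub_ext; apply vcase; reflexivity.
Qed.

Lemma qfree_fsubst (G D : ctx) (A : form G) (f : sub G D) : qfree A -> qfree (fsubst A f).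
Proof. revert D f; induction A; simpl; intuition auto. Qed.

Lemma fsubst_eq_at (s : ty) : forall (G D : ctx) (f : sub G D) (x y : term G s),
  fsubst (eq_at x y) f = eq_at (tsubst f x) (tsubst f y).
Proof.
induction s as [|s _ t IH]; intros G D f x y; simpl; [reflexivity|].
rewrite IH; simpl; rewrite !tsubst_up_wk; reflexivity.
Qed.

(** * Weakening and substitution for derivations *)

Section Proofs.
Variable T : theory.

Lemma prov_mono (G : ctx) (H H' : list (form G)) A :
  prov T H A -> incl H H' -> prov T H' A.
Proof.
intros p; revert H'; induction p; intros H' i.
- now apply p_ax.
- apply p_hyp; auto.
- apply p_raa, IHp; intros x [->|]; simpl; auto.
- apply p_impI, IHp; intros x [->|]; simpl; auto.
- eapply p_impE; eauto.
- apply p_andI; auto.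
- eapply p_andE1; eauto.
- eapply p_andE2; eauto.
- apply p_orI1; auto.
- apply p_orI2; auto.
- eapply p_orE; [eauto|apply IHp2|apply IHp3]; intros x [->|]; simpl; auto.
- apply p_allI, IHp, incl_map, i.
- apply p_allE; auto.
- eapply p_exI; eauto.
- eapply p_exE; [eauto|apply IHp2]. intros x [->|Hx]; simpl; auto.
  right; revert x Hx; apply incl_map, i.
Qed.

(** The Henkin construction moves derivations between contexts, so axioms must remain axioms when
    their parameters are replaced by terms. *)
Definition subst_closed : Prop :=
  forall G D (A : form G) (f : sub G D), T A -> T (fsubst A f).

Lemma map_fwk_fsubst (G D : ctx) u (f : sub G D) (H : list (form G)) :
  map (fun A => fsubst A (up f)) (map (fwk u) H) = map (fwk u) (map (fun A => fsubst A f) H).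
Proof.
rewrite !map_map; apply map_ext; intros A; apply fsubst_up_fwk.
Qed.

Lemma prov_fsubst (G D : ctx) (f : sub G D) (H : list (form G)) A :
  subst_closed -> prov T H A -> prov T (map (fun A => fsubst A f) H) (fsubst A f).
Proof.
intros cl p; revert D f; induction p; intros D f; simpl in *.
- now apply p_ax, cl.
- apply p_hyp, in_map_iff; eauto.
- apply p_raa, (IHp D f).
- apply p_impI, (IHp D f).
- eapply p_impE; [apply (IHp1 D f)|apply (IHp2 D f)].
- apply p_andI; auto.
- eapply p_andE1, (IHp D f).
- eapply p_andE2, (IHp D f).
- apply p_orI1; auto.
- apply p_orI2; auto.
- eapply p_orE; [apply (IHp1 D f)|apply (IHp2 D f)|apply (IHp3 D f)].
- apply p_allI; rewrite <- map_fwk_fsubst; apply (IHp _ (up f)).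
- rewrite fsubst_inst; apply p_allE, (IHp D f).
- apply p_exI with (t := tsubst f t); rewrite <- fsubst_inst; apply (IHp D f).
- apply p_exE with (s := s) (A := fsubst A (up f)); [apply (IHp1 D f)|].
  rewrite <- fsubst_up_fwk, <- map_fwk_fsubst; apply (IHp2 _ (up f)).
Qed.

End Proofs.

Ltac fsubst_norm :=
  cbn [fsubst tsubst]; rewrite ?fsubst_eq_at; cbn [fsubst tsubst].

Lemma subst_closed_QF_AC s t : subst_closed (QF_AC s t).
Proof.
intros G D A f a; revert D f; destruct a as [G B qB]; intros D f; cbn [fsubst].
replace (fsubst (choice_matrix B) (up (up f))) with (choice_matrix (fsubst B (up (up f)))).
{ constructor; now apply qfree_fsubst. }
unfold choice_matrix; rewrite !fsubst_fsubst; f_equal.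
apply sub_ext; apply vcase; [reflexivity|].
intros s'; revert s'; apply vcase; [reflexivity|]; intros s' x; cbn.
unfold wk; rewrite !tsubst_rename, rename_rename, rename_tsubst; reflexivity.
Qed.

Lemma subst_closed_WKL : subst_closed WKL.
Proof. intros G D A f a; revert D f; destruct a; intros D f; exact (wkl D). Qed.

Lemma subst_closed_union T U : subst_closed T -> subst_closed U -> subst_closed (T [U] U).
Proof. intros cT cU G D A f [a|a]; [left|right]; auto. Qed.

Lemma subst_closed_RCA0w : subst_closed RCA0w.
Proof.
intros G D A f a; revert D f; destruct a; intros D g; fsubst_norm; try (constructor; fail).
- rewrite tsubst_up_wk, tsubst_up_wk; apply ax_lt_diff.
- rewrite fsubst_inst; cbn [tsubst].
  replace (fsubst (fsubst A _) _) with
    (fsubst (fsubst A (up g)) (scons (#0 [+] One) (@tvs D N0))).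
  { apply ax_ind; now apply qfree_fsubst. }
  rewrite !fsubst_fsubst; f_equal; apply sub_ext; apply vcase; [reflexivity|].
  intros s x; change (tsubst (scons (#0 [+] One) (@tvs D N0)) (wk (g s x)) = wk (g s x)).
  rewrite tsubst_wk; apply tsubst_tvs.
- now apply ax_ac, subst_closed_QF_AC.
Qed.

(** * Henkin construction *)

Definition pair_code (a b : nat) : nat := Cantor.to_nat (a, b).

Lemma pair_code_inj a b a' b' : pair_code a b = pair_code a' b' -> a = a' /\ b = b'.
Proof. intros H; apply (Cantor.to_nat_inj (_, _) (_, _)) in H; injection H; auto. Qed.

Fixpoint ty_code (s : ty) : nat :=
  match s with
  | N0 => 0
  | Arr s t => S (pair_code (ty_code s) (ty_code t))
  end.

Fixpoint var_code G s (x : var G s) : nat :=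
  match x with vz => 0 | vs y => S (var_code y) end.

(** An application records the argument type, which its own type does not determine. The types in
    [CombK] and [CombS] can be read off the type of the term and are left out. *)
Fixpoint term_code G s (t : term G s) : nat :=
  match t with
  | Var x => pair_code 0 (var_code x)
  | @App _ s _ f u => pair_code 1 (pair_code (ty_code s) (pair_code (term_code f) (term_code u)))
  | Zero => pair_code 2 0
  | One => pair_code 3 0
  | Plus => pair_code 4 0
  | Times => pair_code 5 0
  | CombK _ _ => pair_code 6 0
  | CombS r s t => pair_code 7 0
  | Rec0 => pair_code 8 0
  end.

Fixpoint form_code G (A : form G) : nat :=
  match A with
  | Eq0 t u => pair_code 0 (pair_code (term_code t) (term_code u))
  | Lt0 t u => pair_code 1 (pair_code (term_code t) (term_code u))
  | Bot => pair_code 2 0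
  | Imp A B => pair_code 3 (pair_code (form_code A) (form_code B))
  | And A B => pair_code 4 (pair_code (form_code A) (form_code B))
  | Or A B => pair_code 5 (pair_code (form_code A) (form_code B))
  | @All _ s A => pair_code 6 (pair_code (ty_code s) (form_code A))
  | @Ex _ s A => pair_code 7 (pair_code (ty_code s) (form_code A))
  end.

Ltac code_inv :=
  repeat match goal with
  | H : pair_code _ _ = pair_code _ _ |- _ => apply pair_code_inj in H; destruct H
  | H : S _ = S _ |- _ => injection H; clear H; intros H
  end; try discriminate.

Lemma ty_code_inj s : forall t, ty_code s = ty_code t -> s = t.
Proof.
induction s as [|s IHs t IHt]; intros [|s' t'] H; simpl in H; code_inv; try discriminate; auto.
f_equal; auto.
Qed.

Lemma var_code_inj G s (x : var G s) : forall s' (x' : var G s'),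
  var_code x = var_code x' -> existT (var G) s x = existT (var G) s' x'.
Proof.
induction x as [G s|G s u x IH]; refine (vcase _ _); simpl; intros; try discriminate; auto.
injection H; intros e; specialize (IH _ _ e).
inversion IH; subst; reflexivity.
Qed.

Ltac existT_inv :=
  repeat match goal with
  | H : existT _ _ _ = existT _ _ _ |- _ =>
      first [apply inj_pair2 in H; subst | (inversion H; subst; clear H)]
  end.

(** The hypothesis [s = s'] supplies the types omitted from the codes of the combinators; as an
    equation it still allows [t'] to be destructed. *)
Lemma term_code_inj G s (t : term G s) : forall s' (t' : term G s'),
  s = s' -> term_code t = term_code t' -> existT (term G) s t = existT (term G) s' t'.
Proof.
induction t; intros s' t'; destruct t'; intros e E; simpl in E;
  code_inv; try reflexivity; try (injection e; intros; subst; reflexivity).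
- match goal with H : var_code _ = _ |- _ => apply var_code_inj in H; inversion H; subst end.
  existT_inv; reflexivity.
- match goal with H : ty_code _ = _ |- _ => apply ty_code_inj in H end; subst.
  assert (I1 := IHt1 _ t'1 eq_refl ltac:(assumption)).
  assert (I2 := IHt2 _ t'2 eq_refl ltac:(assumption)).
  apply inj_pair2 in I1, I2; subst; reflexivity.
Qed.

Lemma term_code_inj_eq G s (t t' : term G s) : term_code t = term_code t' -> t = t'.
Proof. intros E; apply inj_pair2 with (P := term G), term_code_inj; auto. Qed.

Lemma form_code_inj G (A : form G) : forall G' (A' : form G'),
  G = G' -> form_code A = form_code A' -> existT form G A = existT form G' A'.
Proof.
induction A; intros G' A'; destruct A'; intros e E; subst; simpl in E; code_inv;
  repeat match goal with
  | H : term_code _ = term_code _ |- _ => apply term_code_inj_eq in H; subst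
  | H : ty_code _ = ty_code _ |- _ => apply ty_code_inj in H; subst
  end; try reflexivity.
all: try (assert (I1 := IHA1 _ A'1 eq_refl ltac:(assumption));
  assert (I2 := IHA2 _ A'2 eq_refl ltac:(assumption));
  apply inj_pair2 in I1, I2; subst; reflexivity).
all: assert (I1 := IHA _ A' eq_refl ltac:(assumption)); apply inj_pair2 in I1; subst; reflexivity.
Qed.

Definition uncode (Y : Type) (d : Y) (c : Y -> nat) (k : nat) : Y :=
  epsilon (inhabits d) (fun y => c y = k).

Lemma uncodeK (Y : Type) (d : Y) (c : Y -> nat) :
  (forall y y', c y = c y' -> y = y') -> forall y, uncode d c (c y) = y.
Proof. intros inj y; apply inj; apply (epsilon_spec (inhabits d) (fun z => c z = c y)); eauto. Qed.

(** Stage [k] adds a free variable of type [wit_ty k] as a witness for the formula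
    [wit_goal k] of some stage [n]; by [wit_goal_surj] every formula gets its turn
    at a stage [k >= n]. *)
Definition wit_ty (k : nat) : ty := uncode N0 ty_code (fst (Cantor.of_nat k)).

Fixpoint stage_ctx (k : nat) : ctx :=
  match k with
  | 0 => nil
  | S k => wit_ty k :: stage_ctx k
  end.

Definition goal_code (s : ty) (y : {n & form (s :: stage_ctx n)}) : nat :=
  pair_code (projT1 y) (form_code (projT2 y)).

Definition wit_goal (k : nat) : {n & form (wit_ty k :: stage_ctx n)} :=
  uncode (existT _ 0 Bot) (@goal_code _) (fst (Cantor.of_nat (snd (Cantor.of_nat k)))).

Lemma goal_code_inj s (y y' : {n & form (s :: stage_ctx n)}) :
  goal_code y = goal_code y' -> y = y'.
Proof.
destruct y as [n B], y' as [n' B']; unfold goal_code; simpl; intros H.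
apply pair_code_inj in H; destruct H as [<- H].
f_equal; apply inj_pair2 with (P := form), form_code_inj; auto.
Qed.

Lemma to_nat_ge_r x y : y <= Cantor.to_nat (x, y).
Proof. pose proof (Cantor.to_nat_spec x y); nia. Qed.

Lemma wit_goal_surj s n (B : form (s :: stage_ctx n)) :
  exists k (e : wit_ty k = s), n <= k /\
    wit_goal k = existT _ n (eq_rect_r (fun s => form (s :: stage_ctx n)) B e).
Proof.
(* The last component is padding: a Cantor code is at least its second component, so including [n]
   forces [n <= k]. *)
pose (k := pair_code (ty_code s) (pair_code (goal_code (existT _ n B)) n)).
assert (e : wit_ty k = s).
{ unfold wit_ty, k, pair_code; rewrite Cantor.cancel_of_to; apply uncodeK, ty_code_inj. }
assert (e2 : fst (Cantor.of_nat (snd (Cantor.of_nat k))) = goal_code (existT _ n B)).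
{ unfold k, pair_code; rewrite Cantor.cancel_of_to; cbn [fst snd]; rewrite Cantor.cancel_of_to; reflexivity. }
assert (nk : n <= k).
{ unfold k, pair_code; etransitivity; [|apply to_nat_ge_r]; apply to_nat_ge_r. }
exists k, e; split; [exact nk|]; unfold wit_goal; rewrite e2.
clearbody k; subst s; apply uncodeK, goal_code_inj.
Qed.

(** An inhabitant of every type: it lets a fresh variable be discarded, and it shows that no domain
    of a model is empty. *)
Fixpoint dflt G (s : ty) : term G s :=
  match s with N0 => Zero | Arr s t => CombK t s @ dflt G t end.

(** A dummy if [k < n]. *)
Fixpoint lift_term n s (t : term (stage_ctx n) s) (k : nat) : term (stage_ctx k) s :=
  match Nat.eq_dec n k with
  | left e => eq_rect n (fun m => term (stage_ctx m) s) t k e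
  | right _ =>
      match k with
      | 0 => dflt _ s
      | S k => wk (lift_term t k)
      end
  end.

Lemma lift_term_same n s (t : term (stage_ctx n) s) : lift_term t n = t.
Proof.
assert (E : forall k, lift_term t k = match Nat.eq_dec n k with
  | left e => eq_rect n (fun m => term (stage_ctx m) s) t k e
  | right _ => match k with 0 => dflt _ s | S k => wk (lift_term t k) end end)
  by (intros []; reflexivity).
rewrite E; destruct (Nat.eq_dec n n) as [e|]; [|congruence].
rewrite (UIP_refl_nat _ e); reflexivity.
Qed.

Lemma lift_term_S n s (t : term (stage_ctx n) s) k : n <= k ->
  lift_term t (S k) = wk (lift_term t k).
Proof.
intros H; cbn [lift_term]; destruct (Nat.eq_dec n (S k)) as [e|]; [lia|reflexivity].
Qed.

Lemma lift_var_S n k s (x : var (stage_ctx n) s) : n <= k ->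
  lift_term (Var x) (S k) = wk (lift_term (Var x) k).
Proof. apply lift_term_S. Qed.

Definition coherent_from (n : nat) s (d : forall k, term (stage_ctx k) s) : Prop :=
  forall k, n <= k -> d (S k) = wk (d k).

Lemma lift_term_coherent n s (t : term (stage_ctx n) s) : coherent_from n (lift_term t).
Proof. intros k; apply lift_term_S. Qed.

(** An element of the direct limit of the terms of all stages. The family is defined at every [k],
    with arbitrary values before some bound, which avoids carrying proofs of [n <= k] in the
    types. *)
Definition thread (s : ty) : Type :=
  {d : forall k, term (stage_ctx k) s | exists n, coherent_from n d}.

Definition at_stage (D : ctx) (rho : forall s, var D s -> thread s) (k : nat) :
    sub D (stage_ctx k) := fun s x => proj1_sig (rho s x) k.

Definition coherent_env_from (n : nat) (D : ctx) (rho : forall s, var D s -> thread s) : Prop :=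
  forall k, n <= k -> forall s x, at_stage rho (S k) x = wk (at_stage rho k x) :> term _ s.

(** A context is finite, so the bounds of its variables have a common one. *)
Lemma env_coherent (D : ctx) (rho : forall s, var D s -> thread s) :
  exists n, coherent_env_from n rho.
Proof.
induction D as [|u D IH].
- exists 0; intros k _; refine (no_var _).
- destruct (IH (fun s x => rho s (vs x))) as [n Hn].
  destruct (rho u vz) as [d [m Hm]] eqn:E.
  exists (n + m); intros k Hk; apply vcase.
  + unfold at_stage; rewrite E; apply Hm; lia.
  + intros s x; apply (Hn k); lia.
Qed.

Section Henkin.
Variables (T : theory) (H0 : list (form nil)).
Hypothesis closedT : subst_closed T.
Hypothesis cons0 : ~ prov T H0 Bot.

Definition consistent G (H : list (form G)) : Prop := ~ prov T H Bot.

Definition wit_form (k : nat) : form (wit_ty k :: stage_ctx k) :=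
  fsubst (projT2 (wit_goal k)) (up (fun s x => lift_term (Var x) k)).

(** Completion and witnessing are done at once: each step decides one existential formula and, if it
    is accepted, makes the new variable its witness. Deciding existential formulas decides all
    formulas, since a vacuous quantifier can be prefixed. *)
Fixpoint stage (k : nat) : list (form (stage_ctx k)) :=
  match k with
  | 0 => H0
  | S k =>
      if excluded_middle_informative (consistent (Ex (wit_ty k) (wit_form k) :: stage k))
      then wit_form k :: map (fwk _) (Ex _ (wit_form k) :: stage k)
      else map (fwk _) ((Ex _ (wit_form k) ==> Bot) :: stage k)
  end.

(** A derivation of [Bot] with a fresh variable is generalised over it and then instantiated at a
    default term. *)
Lemma consistent_fwk G u (H : list (form G)) : consistent H -> consistent (map (fwk u) H).
Proof.
intros c p; apply c.
exact (@p_allE T G H u Bot (dflt G u) (p_allI (A := Bot) p)).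
Qed.

Lemma consistent_split G (H : list (form G)) A :
  consistent H -> ~ consistent (A :: H) -> consistent ((A ==> Bot) :: H).
Proof.
intros c n p; apply n; intros q; apply c.
eapply p_impE; apply p_impI; [exact p|exact q].
Qed.

Lemma stage_consistent k : consistent (stage k).
Proof.
induction k as [|k IH]; [exact cons0|]; simpl.
destruct (excluded_middle_informative _) as [c|n].
- intros p; apply c; eapply p_exE; [apply p_hyp; left; reflexivity|exact p].
- apply (consistent_fwk (H := _ :: _)), consistent_split; auto.
Qed.

Definition holds_at k (A : form (stage_ctx k)) : Prop := prov T (stage k) A.

Lemma holds_S k (A : form (stage_ctx k)) : holds_at A -> holds_at (k := S k) (fwk _ A).
Proof.
intros p; apply (prov_fsubst (tvs (u := wit_ty k)) closedT) in p.
eapply prov_mono; [exact p|]; simpl.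
destruct (excluded_middle_informative _); intros x Hx; simpl; auto.
Qed.

Lemma stage_witness s n (B : form (s :: stage_ctx n)) :
  exists k, n <= k /\
    let sg := fun s x => lift_term (Var x) (S k) in
    (exists c, holds_at (k := S k) (fsubst B (scons c sg))) \/
    holds_at (k := S k) (fsubst (Ex s B) sg ==> Bot).
Proof.
destruct (wit_goal_surj B) as [k [e [nk E]]]; exists k; split; [exact nk|].
subst s; cbn in E; intros sg.
assert (Ew : wit_form k = fsubst B (up (fun s x => lift_term (Var x) k))).
{ unfold wit_form; rewrite E; reflexivity. }
assert (Es : sg = fun s x => wk (lift_term (Var x) k)).
{ apply sub_ext; intros; apply lift_var_S, nk. }
unfold holds_at; simpl stage; rewrite Ew.
destruct (excluded_middle_informative _); [left; exists #0|right]; apply p_hyp; left.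
- unfold up; f_equal; f_equal; symmetry; exact Es.
- change (fwk (wit_ty k) (fsubst (Ex (wit_ty k) B ==> Bot) (fun s x => lift_term (Var x) k)) =
    fsubst (Ex (wit_ty k) B ==> Bot) sg).
  rewrite fwk_fsubst; f_equal; symmetry; exact Es.
Qed.

(** Truth in the direct limit. Only late stages count, so the arbitrary initial values of threads do
    not matter. *)
Definition ev_holds D (A : form D) (rho : forall s, var D s -> thread s) : Prop :=
  exists n, forall k, n <= k -> holds_at (fsubst A (at_stage rho k)).

(** Once the environment is coherent, provability passes from each stage to the next by
    weakening. *)
Lemma ev_of_one D (A : form D) rho n k : coherent_env_from n rho -> n <= k ->
  holds_at (fsubst A (at_stage rho k)) -> ev_holds A rho.
Proof.
intros c nk p; exists k; intros k' H; induction H as [|k' kk' IH]; [exact p|].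
apply holds_S in IH; rewrite fwk_fsubst in IH.
match type of IH with holds_at (fsubst _ ?f) => replace (at_stage rho (S k')) with f; [exact IH|] end.
apply sub_ext; intros; symmetry; apply c; lia.
Qed.

Lemma ev_all_stages D (A : form D) rho :
  (forall k, holds_at (fsubst A (at_stage rho k))) -> ev_holds A rho.
Proof. exists 0; auto. Qed.

Lemma ev_prov D (A B : form D) rho :
  (forall k, prov T (fsubst A (at_stage rho k) :: stage k) (fsubst B (at_stage rho k))) ->
  ev_holds A rho -> ev_holds B rho.
Proof.
intros p [n Hn]; exists n; intros k nk.
eapply p_impE; [apply p_impI, p|apply Hn, nk].
Qed.

Lemma ev_and D (A B : form D) rho : ev_holds A rho -> ev_holds B rho -> ev_holds (A [&] B) rho.
Proof.
intros [n Hn] [m Hm]; exists (n + m); intros k nk; apply p_andI; [apply Hn|apply Hm]; lia.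
Qed.

Lemma ev_mp D (A B : form D) rho : ev_holds (A ==> B) rho -> ev_holds A rho -> ev_holds B rho.
Proof.
intros [n Hn] [m Hm]; exists (n + m); intros k nk.
eapply p_impE; [apply Hn|apply Hm]; lia.
Qed.

Lemma ev_Bot D (rho : forall s, var D s -> thread s) : ~ ev_holds Bot rho.
Proof. intros [n Hn]; exact (stage_consistent (Hn n (le_n n))). Qed.

Lemma at_stage_lift D (rho : forall s, var D s -> thread s) n k : coherent_env_from n rho ->
  n <= k -> forall s x, tsubst (fun s x => lift_term (Var x) k) (at_stage rho n x) = at_stage rho k x :> term _ s.
Proof.
intros c nk s x; induction nk as [|k nk IH].
- rewrite <- (tsubst_id (at_stage rho n x)) at 2; f_equal.
  apply sub_ext; intros; apply lift_term_same.
- rewrite c, <- IH by lia; unfold wk; rewrite rename_of_tsubst; f_equal.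
  apply sub_ext; intros; apply lift_term_S; lia.
Qed.

Definition tcons D u (d : thread u) (rho : forall s, var D s -> thread s) :
    forall s, var (u :: D) s -> thread s := vcase d rho.

(** This is the one place where the choices made in [stage] are used. The formula is frozen at a
    stage [n] at which its environment is coherent, and it gets its turn at some [k >= n]. All
    clauses of the truth definition follow from it by logic. *)
Lemma ev_Ex_dec D s (A : form (s :: D)) rho :
  (exists d, ev_holds A (tcons d rho)) \/ ev_holds (Ex s A ==> Bot) rho.
Proof.
destruct (env_coherent rho) as [n Hn].
destruct (stage_witness (fsubst A (up (at_stage rho n)))) as [k [nk [[c Hc]|Hc]]].
- left.
  exists (exist _ (lift_term c) (ex_intro _ (S k) (lift_term_coherent c))).
  apply ev_of_one with (n := S k) (k := S k); [|auto|].
  + intros k' Hk; apply vcase; [apply lift_term_S, Hk|]; intros; apply Hn; lia.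
  + rewrite fsubst_fsubst in Hc.
    match type of Hc with holds_at (fsubst A ?f) => replace (at_stage _ _) with f; [exact Hc|] end.
    apply sub_ext; apply vcase; [symmetry; apply lift_term_same|]; intros s' x.
    exact (eq_trans (tsubst_wk _ _) (at_stage_lift Hn (le_S _ _ nk) x)).
- right; apply ev_of_one with (n := n) (k := S k); auto.
  change (holds_at (k := S k) (fsubst (fsubst (Ex s A ==> Bot) (at_stage rho n)) (fun s x => lift_term (Var x) (S k)))) in Hc.
  rewrite fsubst_fsubst in Hc.
  match type of Hc with holds_at (fsubst _ ?f) => replace (at_stage rho (S k)) with f; [exact Hc|] end.
  apply sub_ext; intros; apply at_stage_lift; auto.
Qed.

Lemma tcons_at_stage D u (d : thread u) (rho : forall s, var D s -> thread s) k :
  at_stage (tcons d rho) k = scons (proj1_sig d k) (at_stage rho k).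
Proof. apply sub_ext; apply vcase; reflexivity. Qed.

Lemma ev_fwk D u (A : form D) (d : thread u) rho :
  ev_holds (fwk u A) (tcons d rho) <-> ev_holds A rho.
Proof.
unfold ev_holds; split; intros [n Hn]; exists n; intros k nk; specialize (Hn k nk);
  revert Hn; rewrite tcons_at_stage, fsubst_fwk; auto.
Qed.

Lemma ev_dec D (A : form D) rho : ev_holds A rho \/ ev_holds (A ==> Bot) rho.
Proof.
(* [A] is equivalent to its vacuous existential quantification. *)
destruct (ev_Ex_dec (fwk N0 A) rho) as [[d Hd]|H]; [left|right].
- apply ev_fwk in Hd; exact Hd.
- revert H; apply ev_prov; intros k; apply p_impI.
  eapply p_impE; [apply p_hyp; right; left; reflexivity|].
  apply p_exI with (t := Zero); fold fsubst.
  rewrite inst_up, fsubst_fwk; apply p_hyp; left; reflexivity.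
Qed.

Lemma ev_All_inst D s (A : form (s :: D)) rho d :
  ev_holds (All s A) rho -> ev_holds A (tcons d rho).
Proof.
intros [n Hn]; exists n; intros k nk.
rewrite tcons_at_stage, <- inst_up; apply p_allE, (Hn k nk).
Qed.

Lemma ev_Ex_intro D s (A : form (s :: D)) rho d :
  ev_holds A (tcons d rho) -> ev_holds (Ex s A) rho.
Proof.
intros [n Hn]; exists n; intros k nk; cbn [fsubst].
apply p_exI with (t := proj1_sig d k); rewrite inst_up, <- tcons_at_stage; apply (Hn k nk).
Qed.

Lemma ev_Ex D s (A : form (s :: D)) rho :
  ev_holds (Ex s A) rho <-> exists d, ev_holds A (tcons d rho).
Proof.
split; [|intros [d Hd]; eapply ev_Ex_intro; eauto].
intros H; destruct (ev_Ex_dec A rho) as [?|n]; [assumption|].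
destruct (@ev_Bot D rho); eapply ev_mp; eauto.
Qed.

Lemma prov_not_All G s (H : list (form G)) (A : form (s :: G)) :
  prov T ((All s A ==> Bot) :: H) (Ex s (A ==> Bot)).
Proof.
apply p_raa; eapply p_impE; [apply p_hyp; right; left; reflexivity|].
apply p_allI, p_raa; simpl.
eapply p_impE; [apply p_hyp; right; left; reflexivity|].
apply p_exI with (t := #0).
change (prov T ((A ==> Bot) :: (fwk s (Ex s (A ==> Bot)) ==> Bot)
  :: (fwk s (All s A) ==> Bot) :: map (fwk s) H) (inst (fsubst (A ==> Bot) (up (tvs (u:=s)))) #0)).
rewrite inst_vz; apply p_hyp; left; reflexivity.
Qed.

Lemma ev_All D s (A : form (s :: D)) rho :
  ev_holds (All s A) rho <-> forall d, ev_holds A (tcons d rho).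
Proof.
split; [intros; now apply ev_All_inst|]; intros H.
destruct (ev_dec (All s A) rho) as [?|n]; [assumption|exfalso].
assert (E : ev_holds (Ex s (A ==> Bot)) rho).
{ revert n; apply ev_prov; intros k; apply prov_not_All. }
apply ev_Ex in E; destruct E as [d Hd].
apply (@ev_Bot _ (tcons d rho)); eapply ev_mp; eauto.
Qed.

Lemma ev_Imp D (A B : form D) rho :
  ev_holds (A ==> B) rho <-> (ev_holds A rho -> ev_holds B rho).
Proof.
split; [intros; eapply ev_mp; eauto|]; intros H.
destruct (ev_dec A rho) as [a|n].
- generalize (H a); apply ev_prov; intros k; apply p_impI, p_hyp; simpl; auto.
- revert n; apply ev_prov; intros k; apply p_impI, p_raa.
  eapply p_impE; apply p_hyp; simpl; eauto.
Qed.

Lemma ev_And D (A B : form D) rho :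
  ev_holds (A [&] B) rho <-> ev_holds A rho /\ ev_holds B rho.
Proof.
split; [|intros []; now apply ev_and]; intros H; split; revert H; apply ev_prov; intros k;
  [eapply p_andE1|eapply p_andE2]; apply p_hyp; left; reflexivity.
Qed.

Lemma ev_Or D (A B : form D) rho :
  ev_holds (A [|] B) rho <-> ev_holds A rho \/ ev_holds B rho.
Proof.
split.
- intros H; destruct (ev_dec A rho) as [?|na]; [auto|]; destruct (ev_dec B rho) as [?|nb]; [auto|].
  destruct (@ev_Bot D rho); apply ev_mp with (A := A [|] B); [|exact H].
  generalize (ev_and na nb); apply ev_prov; intros k; apply p_impI.
  eapply p_orE; [apply p_hyp; left; reflexivity| |];
    (eapply p_impE; [|apply p_hyp; left; reflexivity]);
    [eapply p_andE1|eapply p_andE2]; apply p_hyp; right; right; left; reflexivity.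
- intros [H|H]; revert H; apply ev_prov; intros k;
    [apply p_orI1|apply p_orI2]; apply p_hyp; left; reflexivity.
Qed.

Lemma ev_ax D (A : form D) rho : T A -> ev_holds A rho.
Proof. intros a; apply ev_all_stages; intros k; apply p_ax, closedT, a. Qed.

End Henkin.

(** * Completeness *)

Record structure : Type := {
  dom :> ty -> Type;
  ap : forall s t, dom (s ~> t) -> dom s -> dom t;
  zero : dom N0;
  one : dom N0;
  plus : dom (N0 ~> N0 ~> N0);
  times : dom (N0 ~> N0 ~> N0);
  kc : forall s t, dom (s ~> t ~> s);
  sc : forall r s t, dom ((r ~> s ~> t) ~> (r ~> s) ~> r ~> t);
  rc : dom (ty1 ~> N0 ~> N0 ~> N0);
  lt : dom N0 -> dom N0 -> Prop
}.

Arguments ap {_ s t} _ _.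
Arguments zero {_}.
Arguments one {_}.
Arguments plus {_}.
Arguments times {_}.
Arguments kc {_ s t}.
Arguments sc {_ r s t}.
Arguments rc {_}.
Arguments lt {_} _ _.

Section Sat.
Variable M : structure.

Fixpoint eval G s (t : term G s) (rho : forall s, var G s -> M s) : M s :=
  match t with
  | Var x => rho _ x
  | App f u => ap (eval f rho) (eval u rho)
  | Zero => zero
  | One => one
  | Plus => plus
  | Times => times
  | CombK s t => kc
  | CombS q s t => sc
  | Rec0 => rc
  end.

Definition econs G u (d : M u) (rho : forall s, var G s -> M s) :
  forall s, var (u :: G) s -> M s := vcase d rho.

Definition enil : forall s, var nil s -> M s :=
  fun s x => match x in var G _ return match G with nil => M s | _ => unit end with
             vz => tt | vs _ => tt end.

Fixpoint sat G (A : form G) : (forall s, var G s -> M s) -> Prop :=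
  match A with
  | Eq0 t u => fun rho => eval t rho = eval u rho
  | Lt0 t u => fun rho => lt (eval t rho) (eval u rho)
  | Bot => fun _ => False
  | Imp A B => fun rho => sat A rho -> sat B rho
  | And A B => fun rho => sat A rho /\ sat B rho
  | Or A B => fun rho => sat A rho \/ sat B rho
  | All s A => fun rho => forall d : M s, sat A (econs d rho)
  | Ex s A => fun rho => exists d : M s, sat A (econs d rho)
  end.

Definition models (T : theory) : Prop := forall G (A : form G) rho, T G A -> sat A rho.

(** As equality at type 0 is interpreted by identity, this makes the defined equality at every type
    identity as well, and [rewrite] is available inside the model. *)
Definition extensional : Prop :=
  forall s t (f g : M (s ~> t)), (forall x, ap f x = ap g x) -> f = g.

Lemma eval_wk G u s (t : term G s) (d : M u) rho : eval (wk t) (econs d rho) = eval t rho.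
Proof. unfold wk; induction t; simpl; congruence. Qed.

Lemma sat_eq_at (ext : extensional) (s : ty) : forall G (x y : term G s) rho,
  sat (eq_at x y) rho <-> eval x rho = eval y rho.
Proof.
induction s as [|s _ t IH]; intros G x y rho; simpl; [tauto|].
split.
- intros H; apply ext; intros d; specialize (H d); apply IH in H; simpl in H.
  rewrite !eval_wk in H; exact H.
- intros H d; apply IH; simpl; rewrite !eval_wk, H; reflexivity.
Qed.

End Sat.

Section TermModel.
Variables (T : theory) (H0 : list (form nil)).
Hypothesis closedT : subst_closed T.
Hypothesis cons0 : ~ prov T H0 Bot.
Hypothesis baseT : forall G (A : form G), RCA0w A -> T A.

Notation holds := (@ev_holds T H0 _).

Lemma tev_coherent D (rho : forall s, var D s -> thread s) s (t : term D s) :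
  exists n, coherent_from n (fun k => tsubst (at_stage rho k) t).
Proof.
destruct (env_coherent rho) as [n Hn]; exists n; intros k nk.
unfold wk; rewrite rename_of_tsubst; f_equal; apply sub_ext; intros; apply Hn, nk.
Qed.

Definition tev D s (t : term D s) (rho : forall s, var D s -> thread s) : thread s :=
  exist _ (fun k => tsubst (at_stage rho k) t) (tev_coherent rho t).

Definition tnil : forall s, var nil s -> thread s :=
  fun s x => match x in var G _ return match G with nil => thread s | _ => unit end with
             vz => tt | vs _ => tt end.

Definition env2 s t (d : thread s) (e : thread t) := tcons d (tcons e tnil).

Definition teq s (d e : thread s) : Prop :=
  holds (eq_at (Var vz) (Var (vs vz))) (env2 d e).

Lemma thread_eq s (d e : thread s) : (forall k, proj1_sig d k = proj1_sig e k) -> d = e.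
Proof.
destruct d as [d Hd], e as [e He]; simpl; intros H.
apply subset_eq_compat, functional_extensionality_dep, H.
Qed.

Lemma teq_ext s (d e d' e' : thread s) : teq d e ->
  (forall k, proj1_sig d k = proj1_sig d' k) -> (forall k, proj1_sig e k = proj1_sig e' k) ->
  teq d' e'.
Proof. intros H Hd He; apply thread_eq in Hd, He; subst; exact H. Qed.

Definition tap s t (d : thread (s ~> t)) (e : thread s) : thread t :=
  tev (Var vz @ Var (vs vz)) (env2 d e).

Lemma holds_eq_at D s (t u : term D s) rho :
  holds (eq_at t u) rho <-> teq (tev t rho) (tev u rho).
Proof.
unfold teq, ev_holds; split; intros [n Hn]; exists n; intros k nk; specialize (Hn k nk);
  revert Hn; rewrite !fsubst_eq_at; auto.
Qed.

Lemma teq_arrow s t (d e : thread (s ~> t)) :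
  teq d e <-> forall x, teq (tap d x) (tap e x).
Proof.
unfold teq at 1; cbn [eq_at]; rewrite (ev_All closedT cons0).
split; intros H x; specialize (H x); [apply holds_eq_at in H|apply holds_eq_at];
  apply (teq_ext H); reflexivity.
Qed.

Lemma holds_ax D (A : form D) rho : RCA0w A -> holds A rho.
Proof. intros a; apply ev_ax; auto. Qed.

Lemma teq_refl s (d : thread s) : teq d d.
Proof.
induction s as [|s _ t IH].
- exact (holds_ax (tcons d tnil) (ax_refl #0)).
- apply teq_arrow; auto.
Qed.

Lemma teq_sym s (d e : thread s) : teq d e -> teq e d.
Proof.
induction s as [|s _ t IH].
- assert (H := holds_ax (env2 d e) (ax_sym #0 #1)).
  rewrite (ev_Imp _ closedT) in H; exact H.
- rewrite !teq_arrow; auto.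
Qed.

Lemma teq_trans s (d e f : thread s) : teq d e -> teq e f -> teq d f.
Proof.
induction s as [|s _ t IH].
- assert (H := holds_ax (tcons d (env2 e f)) (ax_trans #0 #1 #2)).
  rewrite !(ev_Imp _ closedT) in H; exact H.
- rewrite !teq_arrow; eauto.
Qed.

Lemma teq_tap s t (d d' : thread (s ~> t)) (e e' : thread s) :
  teq d d' -> teq e e' -> teq (tap d e) (tap d' e').
Proof.
intros H1 H2; apply teq_trans with (tap d e').
- assert (H := holds_ax (tcons d (env2 e e')) (ax_ext #1 #2 #0)).
  rewrite (ev_Imp _ closedT), !holds_eq_at in H.
  refine (teq_ext (H _) _ _); [refine (teq_ext H2 _ _)| |]; reflexivity.
- apply teq_arrow, H1.
Qed.

(** The quotient by [teq], an equivalence class being given as a predicate, so that equivalent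
    threads yield identical elements. *)
Definition tdom (s : ty) : Type := {P : thread s -> Prop | exists d, P = teq d}.

Definition cls s (d : thread s) : tdom s := exist _ (teq d) (ex_intro _ d eq_refl).

Definition repr s (P : tdom s) : thread s :=
  proj1_sig (constructive_indefinite_description _ (proj2_sig P)).

Lemma cls_eq s (d e : thread s) : cls d = cls e <-> teq d e.
Proof.
split; intros H.
- injection H; intros E; rewrite E; apply teq_refl.
- apply subset_eq_compat; apply functional_extensionality; intros x.
  apply propositional_extensionality; split; intros K; eapply teq_trans; eauto using teq_sym.
Qed.

Lemma cls_repr s (P : tdom s) : cls (repr P) = P.
Proof.
destruct P as [P HP]; unfold repr; simpl.
destruct (constructive_indefinite_description _ HP) as [d Hd]; simpl.
apply subset_eq_compat; auto.
Qed.

Lemma repr_cls s (d : thread s) : teq (repr (cls d)) d.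
Proof. apply cls_eq, cls_repr. Qed.

Definition closed_thread s (t : term nil s) : thread s := tev t tnil.

Definition term_model : structure := {|
  dom := tdom;
  ap := fun s t f x => cls (tap (repr f) (repr x));
  zero := cls (closed_thread Zero);
  one := cls (closed_thread One);
  plus := cls (closed_thread Plus);
  times := cls (closed_thread Times);
  kc := fun s t => cls (closed_thread (CombK s t));
  sc := fun r s t => cls (closed_thread (CombS r s t));
  rc := cls (closed_thread Rec0);
  lt := fun x y => holds (#0 << #1) (env2 (repr x) (repr y))
|}.

Lemma eval_cls D s (t : term D s) (rho : forall s, var D s -> thread s) :
  eval (M := term_model) t (fun s x => cls (rho s x)) = cls (tev t rho).
Proof.
induction t as [s x|s t f IHf u IHu| | | | | | |]; cbn [eval].
2:{ rewrite IHf, IHu; apply cls_eq.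
    refine (teq_ext (teq_tap (repr_cls (tev f rho)) (repr_cls (tev u rho))) _ _); reflexivity. }
all: apply cls_eq; refine (teq_ext (teq_refl _) _ _); reflexivity.
Qed.

(** The truth lemma. Every element is the class of its representative, so quantifiers over the
    quotient become quantifiers over threads. *)
Lemma sat_cls D (A : form D) : forall rho : forall s, var D s -> thread s,
  sat (M := term_model) A (fun s x => cls (rho s x)) <-> holds A rho.
Proof.
assert (Econs : forall D u (d : thread u) (rho : forall s, var D s -> thread s),
  econs (M := term_model) (cls d) (fun s x => cls (rho s x)) =
  fun s x => cls (tcons d rho x)).
{ intros; apply sub_ext; refine (vcase _ _); reflexivity. }
induction A as [D t u|D t u|D|D A IHA B IHB|D A IHA B IHB|D A IHA B IHB|D s A IHA|D s A IHA];
  intros rho; cbn [sat].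
- rewrite !eval_cls, cls_eq; symmetry; apply (@holds_eq_at _ N0).
- rewrite !eval_cls; simpl.
  assert (L : forall x x' y y' : thread N0, teq x x' -> teq y y' ->
    holds (#0 << #1) (env2 x y) -> holds (#0 << #1) (env2 x' y')).
  { intros x x' y y' e1 e2.
    assert (H := holds_ax (tcons x (tcons x' (env2 y y'))) (ax_lt_eq #0 #1 #2 #3)).
    rewrite !(ev_Imp _ closedT) in H; exact (H e1 e2). }
  split.
  + intros H; exact (L _ _ _ _ (repr_cls _) (repr_cls _) H).
  + intros H; exact (L _ _ _ _ (teq_sym (repr_cls (tev t rho))) (teq_sym (repr_cls (tev u rho))) H).
- split; [tauto|apply (ev_Bot cons0)].
- rewrite (ev_Imp _ closedT), IHA, IHB; tauto.
- rewrite ev_And, IHA, IHB; tauto.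
- rewrite (ev_Or closedT cons0), IHA, IHB; tauto.
- rewrite (ev_All closedT cons0); split.
  + intros H d; apply IHA; rewrite <- Econs; apply H.
  + intros H d; rewrite <- (cls_repr d), Econs; apply IHA, H.
- rewrite (ev_Ex closedT cons0); split.
  + intros [d H]; exists (repr d); apply IHA; rewrite <- Econs, cls_repr; exact H.
  + intros [d H]; exists (cls d); rewrite Econs; apply IHA, H.
Qed.

Lemma env_cls D (rho : forall s, var D s -> tdom s) :
  rho = fun s x => cls (repr (rho s x)).
Proof. apply sub_ext; intros; symmetry; apply cls_repr. Qed.

Lemma term_model_models : models term_model T.
Proof. intros G A rho a; rewrite (env_cls rho); apply sat_cls, ev_ax; auto. Qed.

Lemma term_model_ext : extensional term_model.
Proof.
intros s t f g H; rewrite <- (cls_repr f), <- (cls_repr g); apply cls_eq, teq_arrow; intros x.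
assert (E : forall h : tdom (s ~> t), @ap term_model _ _ h (cls x) = cls (tap (repr h) x)).
{ intros h; apply cls_eq, teq_tap; [apply teq_refl|apply repr_cls]. }
apply cls_eq; rewrite <- !E; apply H.
Qed.

Lemma term_model_H0 A : In A H0 -> sat (M := term_model) A (enil _).
Proof.
intros i; replace (enil term_model) with (fun s (x : var nil s) => cls (tnil x)).
2:{ apply sub_ext; refine (no_var _). }
apply sat_cls; apply ev_of_one with (n := 0) (k := 0); auto.
- intros k _; refine (no_var _).
- apply p_hyp; simpl.
  replace (at_stage tnil 0) with (fun s (x : var nil s) => Var x); [now rewrite fsubst_id|].
  apply sub_ext; refine (no_var _).
Qed.

End TermModel.

Theorem completeness (T : theory) (A : form nil) :
  subst_closed T -> (forall G (B : form G), RCA0w B -> T G B) ->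
  (forall M, extensional M -> models M T -> sat (M := M) A (enil M)) -> T |-- A.
Proof.
intros cl base H; apply NNPP; intros n.
assert (c : ~ prov T [A ==> Bot] Bot) by (intros p; apply n, p_raa, p).
assert (K := term_model_H0 cl c base (or_introl eq_refl)); simpl in K; apply K.
apply H; [apply term_model_ext|apply term_model_models]; assumption.
Qed.

(** * Functionals and decidable predicates in models of the base theory *)

Declare Scope m_scope.
Delimit Scope m_scope with m.
Notation "f $ x" := (ap f x) (at level 39, left associativity) : m_scope.
Local Open Scope m_scope.

Definition add (M : structure) (x y : M N0) : M N0 := plus $ x $ y.
Definition mul (M : structure) (x y : M N0) : M N0 := times $ x $ y.
Definition le (M : structure) (x y : M N0) : Prop := lt x y \/ x = y.

Notation "x + y" := (add x y) : m_scope.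
Notation "x * y" := (mul x y) : m_scope.
Notation "x < y" := (lt x y) : m_scope.
Notation "x <= y" := (le x y) : m_scope.
Notation "0" := zero : m_scope.
Notation "1" := one : m_scope.

Section BaseTheory.
Variable M : structure.
Hypothesis ext : extensional M.
Hypothesis base : models M RCA0w.

Notation N := (M N0).

Lemma addA (x y z : N) : x + y + z = x + (y + z).
Proof. exact (base (econs x (econs y (econs z (enil M)))) (ax_addA #0%ho #1%ho #2%ho)). Qed.
Lemma addC (x y : N) : x + y = y + x.
Proof. exact (base (econs x (econs y (enil M))) (ax_addC #0%ho #1%ho)). Qed.
Lemma add0 (x : N) : x + 0 = x.
Proof. exact (base (econs x (enil M)) (ax_add0 #0%ho)). Qed.
Lemma mulA (x y z : N) : x * y * z = x * (y * z).
Proof. exact (base (econs x (econs y (econs z (enil M)))) (ax_mulA #0%ho #1%ho #2%ho)). Qed.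
Lemma mulC (x y : N) : x * y = y * x.
Proof. exact (base (econs x (econs y (enil M))) (ax_mulC #0%ho #1%ho)). Qed.
Lemma mul0 (x : N) : x * 0 = 0.
Proof. exact (base (econs x (enil M)) (ax_mul0 #0%ho)). Qed.
Lemma mul1 (x : N) : x * 1 = x.
Proof. exact (base (econs x (enil M)) (ax_mul1 #0%ho)). Qed.
Lemma mulD (x y z : N) : x * (y + z) = x * y + x * z.
Proof. exact (base (econs x (econs y (econs z (enil M)))) (ax_mulD #0%ho #1%ho #2%ho)). Qed.
Lemma lt_irr (x : N) : ~ x < x.
Proof. exact (base (econs x (enil M)) (ax_lt_irr #0%ho)). Qed.
Lemma lt_trans (x y z : N) : x < y -> y < z -> x < z.
Proof. exact (base (econs x (econs y (econs z (enil M)))) (ax_lt_trans #0%ho #1%ho #2%ho)). Qed.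
Lemma lt_total (x y : N) : x < y \/ x = y \/ y < x.
Proof. exact (base (econs x (econs y (enil M))) (ax_lt_total #0%ho #1%ho)). Qed.
Lemma lt_add (x y z : N) : x < y -> x + z < y + z.
Proof. exact (base (econs x (econs y (econs z (enil M)))) (ax_lt_add #0%ho #1%ho #2%ho)). Qed.
Lemma lt_mul (x y z : N) : 0 < z -> x < y -> x * z < y * z.
Proof. exact (base (econs x (econs y (econs z (enil M)))) (ax_lt_mul #0%ho #1%ho #2%ho)). Qed.
Lemma lt_diff (x y : N) : x < y -> exists z, x + z = y.
Proof. exact (base (econs x (econs y (enil M))) (ax_lt_diff #0%ho #1%ho)). Qed.
Lemma lt01 : (0 : N) < 1.
Proof. exact (base (enil M) (ax_lt01 nil)). Qed.
Lemma discrete (x : N) : 0 < x -> 1 <= x.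
Proof. exact (base (econs x (enil M)) (ax_discrete #0%ho)). Qed.
Lemma nonneg (x : N) : 0 <= x.
Proof. exact (base (econs x (enil M)) (ax_nonneg #0%ho)). Qed.

Lemma kE s t (x : M s) (y : M t) : kc $ x $ y = x.
Proof.
exact (proj1 (sat_eq_at ext _ _ _) (base (econs x (econs y (enil M))) (ax_K #0%ho #1%ho))).
Qed.
Lemma sE r s t (x : M (r ~> s ~> t)) (y : M (r ~> s)) (z : M r) :
  sc $ x $ y $ z = x $ z $ (y $ z).
Proof.
exact (proj1 (sat_eq_at ext _ _ _)
  (base (econs x (econs y (econs z (enil M)))) (ax_S #0%ho #1%ho #2%ho))).
Qed.
Lemma r0E (f : M ty1) (m : N) : rc $ f $ m $ 0 = m.
Proof. exact (base (econs f (econs m (enil M))) (ax_R0 #0%ho #1%ho)). Qed.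
Lemma rSE (f : M ty1) (m n : N) : rc $ f $ m $ (n + 1) = f $ (rc $ f $ m $ n).
Proof. exact (base (econs f (econs m (econs n (enil M)))) (ax_RS #0%ho #1%ho #2%ho)). Qed.

(** * Arithmetic of the discretely ordered semiring *)

Lemma m_semiring : semi_ring_theory (0 : N) 1 (@add M) (@mul M) eq.
Proof.
constructor; intros; rewrite ?(mulC (_ + _)), ?mulD, ?(mulC p n), ?(mulC p m);
  auto using addC, addA, mulC, mulA, eq_sym.
- rewrite addC; apply add0.
- rewrite mulC; apply mul1.
- rewrite mulC; apply mul0.
Qed.
Add Ring m_ring : m_semiring.

Lemma zero_neq_one : (0 : N) <> 1.
Proof. intros E; apply (lt_irr (x := 0)); rewrite E at 2; apply lt01. Qed.

Lemma not_lt0 (x : N) : ~ x < 0.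
Proof.
intros H; destruct (nonneg x) as [H'|<-]; [apply (lt_irr (lt_trans H H'))|apply (lt_irr H)].
Qed.

Lemma le_refl (x : N) : x <= x. Proof. right; reflexivity. Qed.
Lemma lt_le (x y : N) : x < y -> x <= y. Proof. left; assumption. Qed.
Lemma lt_le_trans (x y z : N) : x < y -> y <= z -> x < z.
Proof. intros H [K|<-]; [apply (lt_trans H K)|exact H]. Qed.
Lemma le_lt_trans (x y z : N) : x <= y -> y < z -> x < z.
Proof. intros [K|<-] H; [apply (lt_trans K H)|exact H]. Qed.
Lemma le_trans (x y z : N) : x <= y -> y <= z -> x <= z.
Proof. intros [K|<-] H; [left; apply (lt_le_trans K H)|exact H]. Qed.
Lemma le_not_lt (x y : N) : x <= y -> ~ y < x.
Proof. intros H K; exact (lt_irr (le_lt_trans H K)). Qed.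
Lemma not_lt_le (x y : N) : ~ y < x -> x <= y.
Proof. intros H; destruct (lt_total x y) as [K|[K|K]]; [left|right|]; tauto. Qed.
Lemma le_add (x y z : N) : x <= y -> x + z <= y + z.
Proof. intros [H|<-]; [left; apply lt_add, H|apply le_refl]. Qed.
Lemma le_add2 (x y x' y' : N) : x <= y -> x' <= y' -> x + x' <= y + y'.
Proof.
intros H H'; apply le_trans with (y + x'); [apply le_add, H|].
rewrite (addC y x'), (addC y y'); apply le_add, H'.
Qed.
Lemma le_addr (x y : N) : x <= x + y.
Proof.
replace (x <= x + y) with (0 + x <= y + x) by (f_equal; ring); apply le_add, nonneg.
Qed.
Lemma le_addl (x y : N) : x <= y + x.
Proof. rewrite addC; apply le_addr. Qed.
Lemma le_mul (x y z : N) : x <= y -> x * z <= y * z.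
Proof.
intros [H| <-]; [|apply le_refl]; destruct (nonneg z) as [K|<-]; [left; apply lt_mul; auto|].
rewrite !mul0; apply le_refl.
Qed.
Lemma le_mul2 (x y x' y' : N) : x <= y -> x' <= y' -> x * x' <= y * y'.
Proof.
intros H H'; apply le_trans with (y * x'); [apply le_mul, H|].
rewrite (mulC y x'), (mulC y y'); apply le_mul, H'.
Qed.

Lemma lt_succ (x : N) : x < x + 1.
Proof. rewrite <- (add0 x) at 1; rewrite (addC x 0), (addC x 1); apply lt_add, lt01. Qed.
Lemma lt_succ_le (x y : N) : x < y -> x + 1 <= y.
Proof.
intros H; destruct (lt_diff H) as [z <-].
assert (z0 : 0 < z).
{ destruct (nonneg z) as [K|<-]; [exact K|]; rewrite add0 in H; destruct (lt_irr H). }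
rewrite (addC x 1), (addC x z); apply le_add, discrete, z0.
Qed.
Lemma lt_succ_iff (x y : N) : x < y + 1 <-> x <= y.
Proof.
split; intros H; [|apply (le_lt_trans H), lt_succ].
apply not_lt_le; intros K; exact (le_not_lt (lt_succ_le K) H).
Qed.
Lemma lt_succ_cases (x y : N) : x < y + 1 -> x < y \/ x = y.
Proof. intros H; apply lt_succ_iff in H; exact H. Qed.
Lemma succ_neq0 (x : N) : x + 1 <> 0.
Proof. intros E; apply (@not_lt0 x); rewrite <- E; apply lt_succ. Qed.
Lemma add_inj (x y z : N) : x + z = y + z -> x = y.
Proof.
intros E; destruct (lt_total x y) as [H|[H|H]]; auto; apply (lt_add z) in H; rewrite E in H;
  destruct (lt_irr H).
Qed.
Lemma zero_or_succ (x : N) : x = 0 \/ exists y, x = y + 1.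
Proof.
destruct (nonneg x) as [H|H]; [right|auto].
destruct (discrete H) as [K|<-]; [|exists 0; ring].
destruct (lt_diff K) as [z <-]; exists z; ring.
Qed.
Lemma le_square (x : N) : x <= x * x.
Proof.
destruct (zero_or_succ x) as [->|[y ->]]; [rewrite mul0; apply le_refl|].
replace ((y + 1) * (y + 1)) with ((y + 1) + (y + 1) * y) by ring; apply le_addr.
Qed.

(** * Combinatory completeness with parameters *)

Fixpoint env (G : list ty) : Type :=
  match G with nil => unit | s :: G => (M s * env G)%type end.

(** The innermost variable becomes the last argument, so the element representing a function also
    represents its abstraction over that variable; [rep_lam] rests on this. *)
Fixpoint arr (G : list ty) (t : ty) : ty :=
  match G with nil => t | s :: G => arr G (s ~> t) end.

Fixpoint apn (G : list ty) : env G -> forall t, M (arr G t) -> M t :=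
  match G return env G -> forall t, M (arr G t) -> M t with
  | nil => fun _ t m => m
  | s :: G => fun e t m => @apn G (snd e) (s ~> t) m $ fst e
  end.

(** The contexts of [rep] and [dec] list the bound variables, the innermost one
    first, as nested pairs; closure under the term formers is bracket abstraction. *)
Definition rep G t (F : env G -> M t) : Prop :=
  exists m : M (arr G t), forall e, apn e m = F e.

Lemma rep_const G t (c : M t) : rep (fun _ : env G => c).
Proof.
revert t c; induction G as [|s G IH]; intros t c; [exists c; reflexivity|].
destruct (IH _ (kc $ c : M (s ~> t))) as [m Hm]; exists m; intros e; simpl; rewrite Hm; apply kE.
Qed.

Lemma rep_app G s t (F : env G -> M (s ~> t)) (X : env G -> M s) :
  rep F -> rep X -> rep (fun e => F e $ X e).
Proof.
revert s t F X; induction G as [|u G IH]; intros s t F X [f Hf] [x Hx].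
- exists (f $ x); intros e; simpl in *; rewrite <- Hf, <- Hx; reflexivity.
- destruct (IH _ _ (fun e => sc $ apn e f) (fun e => apn e x)) as [m Hm].
  { apply IH; [apply rep_const|exists f; reflexivity]. }
  { exists x; reflexivity. }
  exists m; intros e; simpl; rewrite Hm, sE, <- Hf, <- Hx; reflexivity.
Qed.

Lemma rep_fst G s : rep (fun e : env (s :: G) => fst e).
Proof.
destruct (@rep_const G _ (sc $ kc $ (kc : M (s ~> s ~> s)))) as [m Hm].
exists m; intros e; simpl; rewrite Hm, sE, kE; reflexivity.
Qed.

Lemma rep_snd G s t (F : env G -> M t) : rep F -> rep (fun e : env (s :: G) => F (snd e)).
Proof.
intros H; destruct (rep_app (rep_const _ (kc : M (t ~> s ~> t))) H) as [m Hm].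
exists m; intros e; simpl; rewrite Hm, kE; reflexivity.
Qed.

Lemma rep_at G s t (F : env (s :: G) -> M t) (e : env G) : rep F -> rep (fun x : env [s] => F (fst x, e)).
Proof. intros [m Hm]; exists (apn e m); intros x; simpl; rewrite <- Hm; reflexivity. Qed.

Lemma m_inhabited t : inhabited (M t).
Proof. constructor; exact (eval (dflt nil t) (enil M)). Qed.

(** Defined for every [F], with an unspecified value when [F] is not representable. Terms can thus
    be written freely, and representability is proved only when [lamE] is used. *)
Definition lam s t (F : M s -> M t) : M (s ~> t) :=
  epsilon (m_inhabited _) (fun m => forall x, m $ x = F x).

Lemma lamE s t (F : M s -> M t) x : rep (fun e : env [s] => F (fst e)) -> lam F $ x = F x.
Proof.
intros [m Hm]; revert x; unfold lam; apply epsilon_spec; exists m; intros x; apply (Hm (x, tt)).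
Qed.

Lemma rep_lam G s t (F : env G -> M s -> M t) :
  rep (fun e : env (s :: G) => F (snd e) (fst e)) -> rep (fun e => lam (F e)).
Proof.
intros H; destruct (H) as [m Hm]; exists m; intros e; apply ext; intros x.
rewrite lamE by exact (rep_at e H); apply (Hm (x, e)).
Qed.

Lemma rep_add G (x y : env G -> N) : rep x -> rep y -> rep (fun e => x e + y e).
Proof. intros; apply rep_app; [apply rep_app; [apply rep_const|]|]; assumption. Qed.
Lemma rep_mul G (x y : env G -> N) : rep x -> rep y -> rep (fun e => x e * y e).
Proof. intros; apply rep_app; [apply rep_app; [apply rep_const|]|]; assumption. Qed.

(** * Decidable predicates, induction, bounded search and choice *)

Definition ite t (P : Prop) (x y : M t) : M t := if excluded_middle_informative P then x else y.

Lemma ite_true t (P : Prop) (x y : M t) : P -> ite P x y = x.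
Proof. intros p; unfold ite; destruct (excluded_middle_informative P); tauto. Qed.
Lemma ite_false t (P : Prop) (x y : M t) : ~ P -> ite P x y = y.
Proof. intros p; unfold ite; destruct (excluded_middle_informative P); tauto. Qed.

Definition ind (P : Prop) : N := ite P 0 1.

Lemma ind_eq0 (P : Prop) : ind P = 0 <-> P.
Proof.
unfold ind; destruct (classic P) as [p|p]; [rewrite ite_true|rewrite ite_false]; try tauto.
split; [intros H; destruct (zero_neq_one (eq_sym H))|tauto].
Qed.

Lemma ind_ext (P Q : Prop) : (P <-> Q) -> ind P = ind Q.
Proof.
intros H; unfold ind; destruct (classic P); [rewrite !ite_true|rewrite !ite_false]; tauto.
Qed.

Definition dec G (P : env G -> Prop) : Prop := rep (fun e => ind (P e)).

Lemma rep_ext G t (F F' : env G -> M t) : (forall e, F e = F' e) -> rep F -> rep F'.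
Proof. intros H [m Hm]; exists m; intros e; rewrite <- H; apply Hm. Qed.

Lemma dec_ext G (P Q : env G -> Prop) : (forall e, P e <-> Q e) -> dec P -> dec Q.
Proof. intros H; apply rep_ext; intros e; apply ind_ext, H. Qed.

Lemma rep_ite G (P : env G -> Prop) (x y : env G -> N) :
  dec P -> rep x -> rep y -> rep (fun e => ite (P e) (x e) (y e)).
Proof.
intros hP hx hy.
(* Recursion on the indicator: the start value is [x] and the step is constantly [y]. *)
assert (H : rep (fun e => rc $ (kc $ y e) $ x e $ ind (P e))).
{ apply rep_app; [|exact hP]; apply rep_app; [|exact hx]; apply rep_app; [apply rep_const|].
  apply rep_app; [apply rep_const|exact hy]. }
revert H; apply rep_ext; intros e; unfold ind; destruct (classic (P e)) as [p|p].
- rewrite !ite_true by assumption; apply r0E.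
- rewrite !ite_false by assumption; replace (1 : N) with ((0 : N) + 1) by ring.
  rewrite rSE; apply kE.
Qed.

Lemma rep_ind G (P : env G -> Prop) : dec P -> rep (fun e => ind (P e)).
Proof. trivial. Qed.

Lemma dec_const G (P : Prop) : dec (fun _ : env G => P).
Proof. exact (rep_const G (ind P)). Qed.

Lemma dec_imp G (P Q : env G -> Prop) : dec P -> dec Q -> dec (fun e => P e -> Q e).
Proof.
intros hP hQ; generalize (rep_ite hP hQ (rep_const G 0)); apply rep_ext; intros e.
destruct (classic (P e)); [rewrite ite_true by assumption; apply ind_ext; tauto|].
rewrite ite_false by assumption; symmetry; apply ind_eq0; tauto.
Qed.

Lemma dec_not G (P : env G -> Prop) : dec P -> dec (fun e => ~ P e).
Proof. intros; apply dec_imp; [assumption|apply dec_const]. Qed.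

Lemma dec_and G (P Q : env G -> Prop) : dec P -> dec Q -> dec (fun e => P e /\ Q e).
Proof.
intros; apply dec_ext with (fun e => ~ (P e -> ~ Q e)); [intros e; tauto|].
apply dec_not, dec_imp; [|apply dec_not]; assumption.
Qed.

Lemma dec_or G (P Q : env G -> Prop) : dec P -> dec Q -> dec (fun e => P e \/ Q e).
Proof.
intros; apply dec_ext with (fun e => ~ P e -> Q e); [intros e; tauto|].
apply dec_imp; [apply dec_not|]; assumption.
Qed.

(** The order is a relation symbol, and no term is given for its characteristic function.
    QF-AC^{1,0} yields a functional comparing [f $ 0] with [f $ 1]; the recursor builds an [f] with
    any two prescribed values there. *)
Lemma dec_lt G (x y : env G -> N) : rep x -> rep y -> dec (fun e => x e < y e).
Proof.
intros hx hy.
pose (A := (Or (And (Lt0 (App #1 Zero) (App #1 One)) (Eq0 #0 Zero))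
  (And (Imp (Lt0 (App #1 Zero) (App #1 One)) Bot) (Eq0 #0 One)) : form [N0; ty1])%ho).
assert (qA : qfree A) by (simpl; tauto).
destruct (base (enil M) (ax_ac (qf_ac qA))) as [L HL].
{ simpl; intros f; destruct (classic (f $ 0 < f $ 1)) as [H|H];
    [exists 0; left|exists 1; right]; auto. }
simpl in HL.
assert (HL' : forall f, L $ f = ind (f $ 0 < f $ 1)).
{ intros f; unfold ind; destruct (HL f) as [[H E]|[H E]];
    [rewrite ite_true|rewrite ite_false]; assumption. }
assert (H : rep (fun e => L $ (rc $ (kc $ y e) $ x e))).
{ apply rep_app; [apply rep_const|]; apply rep_app; [|exact hx].
  apply rep_app; [apply rep_const|]; apply rep_app; [apply rep_const|exact hy]. }
revert H; apply rep_ext; intros e; rewrite HL'; apply ind_ext.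
assert (E1 : rc $ (kc $ y e) $ x e $ 1 = y e).
{ replace (1 : N) with ((0 : N) + 1) by ring; rewrite rSE; apply kE. }
rewrite r0E, E1; tauto.
Qed.

Lemma dec_eq G (x y : env G -> N) : rep x -> rep y -> dec (fun e => x e = y e).
Proof.
intros; apply dec_ext with (fun e => ~ x e < y e /\ ~ y e < x e).
- intros e; split; [intros []; destruct (lt_total (x e) (y e)) as [?|[?|?]]; tauto|].
  intros ->; split; apply lt_irr.
- apply dec_and; apply dec_not, dec_lt; assumption.
Qed.

Lemma dec_le G (x y : env G -> N) : rep x -> rep y -> dec (fun e => x e <= y e).
Proof. intros; apply dec_or; [apply dec_lt|apply dec_eq]; assumption. Qed.

(** The equation [m $ n = 0] is quantifier-free in the parameter [m], so the axiom covers every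
    predicate with a characteristic function in the model. *)
Lemma induct (P : N -> Prop) : dec (fun e : env [N0] => P (fst e)) ->
  P 0 -> (forall n, P n -> P (n + 1)) -> forall n, P n.
Proof.
intros [m Hm] H0 HS n.
assert (E : forall n, m $ n = 0 <-> P n) 
  by (intros k; change (m $ k) with (apn (G := [N0]) (k, tt) m); rewrite Hm; apply ind_eq0).
pose (A := (Eq0 (App #1 #0) Zero : form [N0; ty1])%ho).
assert (qA : qfree A) by (simpl; tauto).
apply E; revert n; apply (base (econs m (enil M)) (ax_ind qA)); simpl.
- apply E, H0.
- intros k Hk; apply E, HS, E, Hk.
Qed.

Ltac nat_induct n :=
  pattern n; match goal with |- ?P n => refine (@induct P _ _ _ n) end; clear n; cbv beta.

(** The least [i < n] violating [P], or [n] if there is none. *)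
Definition upto (P : N -> Prop) (n : N) : N := rc $ lam (fun i => ite (P i) (i + 1) i) $ 0 $ n.

Lemma rep_upto G (P : env G -> N -> Prop) (n : env G -> N) :
  dec (fun e : env (N0 :: G) => P (snd e) (fst e)) -> rep n -> rep (fun e => upto (P e) (n e)).
Proof.
intros hP hn; apply rep_app; [|exact hn]; apply rep_app; [|apply rep_const].
apply rep_app; [apply rep_const|]; apply rep_lam.
apply rep_ite; [exact hP| |apply rep_fst].
apply rep_add; [apply rep_fst|apply rep_const].
Qed.

Lemma upto_spec (P : N -> Prop) : dec (fun e : env [N0] => P (fst e)) -> forall n,
  upto P n <= n /\ (forall i, i < upto P n -> P i) /\ (upto P n = n \/ ~ P (upto P n)).
Proof.
intros hP.
assert (E0 : upto P 0 = 0) by apply r0E.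
assert (ES : forall n, upto P (n + 1) = ite (P (upto P n)) (upto P n + 1) (upto P n)).
{ intros n; unfold upto; rewrite rSE, lamE; [reflexivity|].
  apply rep_ite; [exact hP| |apply rep_fst].
  apply rep_add; [apply rep_fst|apply rep_const]. }
assert (R : rep (fun e : env [N0] => upto P (fst e))) by (apply rep_app; [apply rep_const|apply rep_fst]).
assert (hR : dec (fun e : env [N0] => P (upto P (fst e)))).
{ destruct hP as [m Hm]; apply rep_ext with (fun e : env [N0] => (m : M (N0 ~> N0)) $ upto P (fst e));
    [intros e; exact (Hm (upto P (fst e), tt))|apply rep_app; [apply rep_const|exact R]]. }
assert (C : forall n, (P (upto P n) /\ upto P (n + 1) = upto P n + 1) \/
  (~ P (upto P n) /\ upto P (n + 1) = upto P n)).
{ intros n; rewrite ES; destruct (classic (P (upto P n))) as [p|p];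
    [left; rewrite ite_true|right; rewrite ite_false]; auto. }
intros n; split; [|split].
- nat_induct n.
  + apply dec_le; [exact R|apply rep_fst].
  + rewrite E0; apply le_refl.
  + intros n IH; destruct (C n) as [[_ ->]|[_ ->]]; [apply le_add, IH|].
    apply (le_trans IH), lt_le, lt_succ.
- intros i; nat_induct n.
  + apply dec_imp; [apply dec_lt; [apply rep_const|exact R]|apply dec_const].
  + rewrite E0; intros H; destruct (not_lt0 H).
  + intros n IH; destruct (C n) as [[p ->]|[_ ->]]; [|exact IH]; intros H.
    destruct (lt_succ_cases H) as [K| ->]; auto.
- nat_induct n.
  + apply dec_or; [apply dec_eq; [exact R|apply rep_fst]|apply dec_not, hR].
  + left; exact E0.
  + intros n [IH|IH]; destruct (C n) as [[p Q]|[p Q]]; rewrite Q; try tauto; left; congruence.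
Qed.

Lemma dec_ball G (n : env G -> N) (P : env G -> N -> Prop) :
  rep n -> dec (fun e : env (N0 :: G) => P (snd e) (fst e)) ->
  dec (fun e => forall i, i < n e -> P e i).
Proof.
intros hn hP; apply dec_ext with (fun e => upto (P e) (n e) = n e).
- intros e; destruct (@upto_spec (P e) (rep_at e hP) (n e)) as [H1 [H2 H3]]; split.
  + intros E i; rewrite <- E; apply H2.
  + intros H; destruct H3 as [?|H3]; [assumption|].
    destruct H1 as [H1|H1]; [destruct (H3 (H _ H1))|exact H1].
- apply dec_eq; [apply rep_upto|]; assumption.
Qed.

Lemma dec_bex G (n : env G -> N) (P : env G -> N -> Prop) :
  rep n -> dec (fun e : env (N0 :: G) => P (snd e) (fst e)) ->
  dec (fun e => exists i, i < n e /\ P e i).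
Proof.
intros hn hP; apply dec_ext with (fun e => ~ forall i, i < n e -> ~ P e i).
- intros e; split; [|firstorder]; intros H; apply NNPP; intros K; apply H; firstorder.
- apply dec_not, dec_ball; [|apply dec_not]; assumption.
Qed.

Lemma choice_of_qf s : models M (QF_AC s N0) -> forall P : M s -> N -> Prop,
  dec (fun e : env [N0; s] => P (fst (snd e)) (fst e)) ->
  (forall x, exists n, P x n) -> exists Y : M (s ~> N0), forall x, P x (Y $ x).
Proof.
intros ac P [m Hm] tot.
assert (E : forall x n, m $ x $ n = 0 <-> P x n).
{ intros x n; change (m $ x $ n) with (apn (G := [N0; s]) (n, (x, tt)) m); rewrite Hm; apply ind_eq0. }
pose (A := (Eq0 (App (App #2 #1) #0) Zero : form [N0; s; s ~> N0 ~> N0])%ho).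
assert (qA : qfree A) by (simpl; tauto).
destruct (ac _ _ (econs m (enil M)) (qf_ac qA)) as [Y HY]; simpl in *.
- intros x; destruct (tot x) as [n Hn]; exists n; apply E, Hn.
- exists Y; intros x; apply E, HY.
Qed.

Lemma choice1 (P : M ty1 -> N -> Prop) :
  dec (fun e : env [N0; ty1] => P (fst (snd e)) (fst e)) ->
  (forall x, exists n, P x n) -> exists Y : M ty2, forall x, P x (Y $ x).
Proof. apply choice_of_qf; intros G A rho a; apply base, ax_ac, a. Qed.

(** QF-AC^{0,0} from QF-AC^{1,0}: a number is passed as the constant function with that value and
    read back at 0. *)
Lemma choice0 (P : N -> N -> Prop) :
  dec (fun e : env [N0; N0] => P (fst (snd e)) (fst e)) ->
  (forall x, exists n, P x n) -> exists Y : M ty1, forall x, P x (Y $ x).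
Proof.
intros [m Hm] tot.
destruct (@choice1 (fun f n => P (f $ 0) n)) as [Y HY]; [|intros x; apply tot|].
- apply rep_ext with (fun e : env [N0; ty1] => (m : M (N0 ~> N0 ~> N0)) $ (fst (snd e) $ 0) $ fst e).
  { intros e; exact (Hm (fst e, (_, tt))). }
  apply rep_app; [|apply rep_fst]; apply rep_app; [apply rep_const|].
  apply rep_app; [apply rep_snd, rep_fst|apply rep_const].
- assert (R : rep (fun e : env [N0] => Y $ (kc $ fst e))).
  { apply rep_app; [apply rep_const|]; apply rep_app; [apply rep_const|apply rep_fst]. }
  exists (lam (fun n => Y $ (kc $ n))); intros x; rewrite lamE by exact R.
  generalize (HY (kc $ x)); rewrite kE; auto.
Qed.


(** A hook, redefined once quantifiers over Cantor space become decidable. *)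
Ltac rp_extra := fail.
Ltac rp :=
  cbv beta;
  lazymatch goal with
  | |- dec (fun _ => ?P) => apply dec_const
  | |- rep (fun _ => ?c) => apply rep_const
  | |- dec _ => first [assumption | rp_extra | rp_dec]
  | |- rep _ => first [assumption | rp_rep]
  end
with rp_dec :=
  lazymatch goal with
  | |- dec (fun e => @?a e = @?b e) => apply dec_eq; rp
  | |- dec (fun e => @?a e < @?b e) => apply dec_lt; rp
  | |- dec (fun e => @?a e <= @?b e) => apply dec_le; rp
  | |- dec (fun e => @?a e /\ @?b e) => apply dec_and; rp
  | |- dec (fun e => @?a e \/ @?b e) => apply dec_or; rp
  | |- dec (fun e => ~ @?a e) => apply dec_not; rp
  | |- dec (fun e => forall i, i < @?n e -> @?P e i) => apply dec_ball; rp
  | |- dec (fun e => exists i, i < @?n e /\ @?P e i) => apply dec_bex; rp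
  | |- dec (fun e => @?a e -> @?b e) => apply dec_imp; rp
  end
with rp_rep :=
  lazymatch goal with
  | |- rep fst => apply rep_fst
  | |- rep (fun e => fst (@?x e)) => rp_var
  | |- rep (fun e => @?a e + @?b e) => apply rep_add; rp
  | |- rep (fun e => @?a e * @?b e) => apply rep_mul; rp
  | |- rep (fun e => ind (@?P e)) => apply rep_ind; rp
  | |- rep (fun e => ite (@?P e) (@?a e) (@?b e)) => apply rep_ite; rp
  | |- rep (fun e => lam (@?F e)) => apply rep_lam; rp
  | |- rep (fun e => upto (@?P e) (@?n e)) => apply rep_upto; rp
  | |- rep (fun e => @?f e $ @?x e) => apply rep_app; rp
  end
with rp_var :=
  first [ exact (@rep_fst _ _)
        | exact (rep_snd _ (@rep_fst _ _))
        | exact (rep_snd _ (rep_snd _ (@rep_fst _ _)))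
        | exact (rep_snd _ (rep_snd _ (rep_snd _ (@rep_fst _ _))))
        | exact (rep_snd _ (rep_snd _ (rep_snd _ (rep_snd _ (@rep_fst _ _)))))
        | exact (rep_snd _ (rep_snd _ (rep_snd _ (rep_snd _ (rep_snd _ (@rep_fst _ _)))))) ].

Ltac betas := repeat (rewrite lamE by rp).

(** * Pairing and finite sequences *)

(** The value lies between the squares of [a + c] and [a + c + 1], which determines the sum and then
    [a]. With this choice [pair c a + 1] is exactly [snoc_code]. *)
Definition pair (a c : N) : N := (a + c) * (a + c) + a.

Lemma pair_inj a c a' c' : pair a c = pair a' c' -> a = a' /\ c = c'.
Proof.
assert (L : forall a c a' c', a + c < a' + c' -> pair a c < pair a' c').
{ intros x y x' y' H; unfold pair.
  apply lt_le_trans with ((x + y + 1) * (x + y + 1)).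
  - replace ((x + y + 1) * (x + y + 1)) with ((x + y) * (x + y) + x + (x + y + y) + 1) by ring.
    apply lt_succ_iff, le_addr.
  - apply le_trans with ((x' + y') * (x' + y')); [|apply le_addr].
    apply le_mul2; apply lt_succ_le, H. }
intros E.
assert (S : a + c = a' + c').
{ destruct (lt_total (a + c) (a' + c')) as [H|[H|H]]; auto; apply L in H; rewrite E in H;
    destruct (lt_irr H). }
unfold pair in E; rewrite S in E; rewrite !(addC (_ * _)) in E; apply add_inj in E.
split; [exact E|]; rewrite E, !(addC a') in S; exact (add_inj S).
Qed.

Lemma le_pair_l a c : a <= pair a c.
Proof. apply le_addl. Qed.

Lemma le_pair_r a c : c <= pair a c.
Proof.
apply le_trans with (a + c); [apply le_addl|]; apply le_trans with ((a + c) * (a + c));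
  [apply le_square|apply le_addr].
Qed.

Definition pfst : M ty1 := epsilon (m_inhabited _) (fun p => forall a c, p $ pair a c = a).
Definition psnd : M ty1 := epsilon (m_inhabited _) (fun p => forall a c, p $ pair a c = c).

Lemma pfstE a c : pfst $ pair a c = a.
Proof.
revert a c; unfold pfst; apply epsilon_spec.
(* The bounds keep the predicate decidable and lose nothing, as components never exceed their pair.
   Numbers that are not pairs get the value 0. *)
destruct (@choice0 (fun p a => forall x, x < p + 1 -> forall y, y < p + 1 -> p = pair x y -> a = x))
  as [Y HY].
- unfold pair; rp.
- intros p; destruct (classic (exists a c, p = pair a c)) as [[a [c ->]]|H].
  + exists a; intros x _ y _ E; apply (pair_inj E).
  + exists 0; intros x _ y _ E; destruct H; eauto.
- exists Y; intros a c; apply (HY (pair a c)) with c; auto; apply lt_succ_iff;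
    [apply le_pair_l|apply le_pair_r].
Qed.

Lemma psndE a c : psnd $ pair a c = c.
Proof.
revert a c; unfold psnd; apply epsilon_spec.
destruct (@choice0 (fun p a => forall x, x < p + 1 -> forall y, y < p + 1 -> p = pair x y -> a = y))
  as [Y HY].
- unfold pair; rp.
- intros p; destruct (classic (exists a c, p = pair a c)) as [[a [c ->]]|H].
  + exists c; intros x _ y _ E; apply (pair_inj E).
  + exists 0; intros x _ y _ E; destruct H; eauto.
- exists Y; intros a c; apply (HY (pair a c)) with a; auto; apply lt_succ_iff;
    [apply le_pair_l|apply le_pair_r].
Qed.

(** Choice gives a function turning a witness for [n] into one for [n + 1]; iterating it produces
    all witnesses, and their correctness is decidable. The recursor does not pass the counter to its
    step function, so the state is a pair containing it. *)
Lemma sigma1_induct (P : N -> N -> Prop) :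
  dec (fun e : env [N0; N0] => P (fst (snd e)) (fst e)) ->
  (exists c, P 0 c) -> (forall n c, P n c -> exists c', P (n + 1) c') ->
  forall n, exists c, P n c.
Proof.
intros [m Hm] [c0 H0] HS n.
assert (E : forall n c, (m : M (N0 ~> N0 ~> N0)) $ n $ c = 0 <-> P n c).
{ intros k c; change (ap (ap m k) c) with (apn (G := [N0; N0]) (c, (k, tt)) m); rewrite Hm; apply ind_eq0. }
clear Hm; simpl in m.
destruct (@choice0 (fun p c => m $ (pfst $ p) $ (psnd $ p) = 0 -> m $ (pfst $ p + 1) $ c = 0))
  as [h Hh]; [rp| |].
{ intros p; destruct (classic (m $ (pfst $ p) $ (psnd $ p) = 0)) as [H|H]; [|exists 0; tauto].
  apply E, HS in H; destruct H as [c Hc]; exists c; intros _; apply E, Hc. }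
pose (st := lam (fun p => pair (pfst $ p + 1) (h $ p))).
pose (q := fun n => rc $ st $ pair 0 c0 $ n).
assert (I : pfst $ q n = n /\ m $ n $ (psnd $ q n) = 0).
{ unfold q, st; nat_induct n; [unfold pair; rp| |].
  - rewrite r0E, pfstE, psndE; split; [reflexivity|apply E, H0].
  - intros n; fold st; rewrite rSE; fold (q n); intros [I1 I2].
    unfold st; rewrite lamE by (unfold pair; rp); rewrite pfstE, psndE, I1; split; [reflexivity|].
    rewrite <- I1 at 1; apply Hh; rewrite I1; exact I2. }
exists (psnd $ q n); apply E, I.
Qed.

(** Kept convertible to the interpretation of [in_cantor]; [in_CE] is the form used in arguments. *)
Definition in_C (f : M ty1) : Prop := forall x, f $ x <= kc $ 1 $ x.

Lemma in_CE f : in_C f <-> forall x, f $ x <= 1.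
Proof. split; intros H x; specialize (H x); revert H; rewrite kE; auto. Qed.

Definition agree (f g : M ty1) (n : N) : Prop := forall i, i < n -> f $ i = g $ i.

Lemma le1_cases (x : N) : x <= 1 -> x = 0 \/ x = 1.
Proof.
intros [H|H]; [left|auto]; destruct (nonneg x) as [K|K]; [|auto].
destruct (le_not_lt (discrete K) H).
Qed.

(** A number is read as a stream with head [pfst] and tail [psnd]. Any finite sequence can be
    prescribed as a beginning, so the functions [dcd $ c] are dense in Baire space. *)
Definition dcd : M (N0 ~> ty1) := lam (fun c => lam (fun i => pfst $ (rc $ psnd $ c $ i))).

Lemma dcdE c i : dcd $ c $ i = pfst $ (rc $ psnd $ c $ i).
Proof. unfold dcd; betas; reflexivity. Qed.

Lemma dcd0 a c : dcd $ pair a c $ 0 = a.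
Proof. rewrite dcdE, r0E; apply pfstE. Qed.

Lemma dcdS a c i : dcd $ pair a c $ (i + 1) = dcd $ c $ i.
Proof.
rewrite !dcdE, rSE; f_equal.
nat_induct i; [rp|rewrite !r0E; apply psndE|]; intros i IH; rewrite !rSE, IH; reflexivity.
Qed.

(** Every element of Cantor space has a code [c <= cbound n] for its first [n] values,
    since [pair b c <= (c + 1)^2 + 1] for [b <= 1]. *)
Definition cbound (n : N) : N := rc $ lam (fun x => (x + 1) * (x + 1) + 1) $ 0 $ n.

Lemma dcd_dense f n : exists c, (in_C f -> c <= cbound n) /\ agree (dcd $ c) f n.
Proof.
(* The code is built from the end: [c] describes the last [k] of the [n] values, starting at the [j]
   with [j + k = n]. For [k] beyond [n] no such [j] exists, and any code within the bound will
   do. *)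
destruct (@sigma1_induct (fun k c => (in_C f -> c <= cbound k) /\
  forall i, i < k -> forall j, j < n + 1 -> j + k = n -> dcd $ c $ i = f $ (j + i))) with n
  as [c [Hc1 Hc2]].
- unfold cbound; rp.
- exists 0; split; [intros _; apply nonneg|]; intros i H; destruct (not_lt0 H).
- intros k c [H1 H2].
  destruct (classic (exists j, j + (k + 1) = n)) as [[j Hj]|H].
  + exists (pair (f $ j) c); split.
    * intros C; unfold cbound; rewrite rSE; fold (cbound k); rewrite lamE by rp.
      assert (Cj := proj1 (in_CE f) C j).
      assert (L : f $ j + c <= cbound k + 1) by (rewrite (addC (f $ j)); apply le_add2; auto).
      apply le_add2; [apply le_mul2; exact L|exact Cj].
    * intros i Hi j' _ Hj'.
      assert (j' = j) as -> by (apply (add_inj (z := k + 1)); congruence).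
      destruct (zero_or_succ i) as [->|[i' ->]]; [rewrite dcd0, add0; reflexivity|].
      rewrite dcdS, (H2 i') with (j := j + 1); [f_equal; ring| | |].
      -- apply lt_succ_iff in Hi; apply (lt_le_trans (lt_succ i') Hi).
      -- apply lt_succ_iff; rewrite <- Hj; replace (j + (k + 1)) with (j + 1 + k) by ring.
         apply le_addr.
      -- rewrite <- Hj; ring.
  + exists 0; split; [intros _; apply nonneg|]; intros i _ j _ Hj; destruct H; eauto.
- exists c; split; [exact Hc1|]; intros i Hi.
  rewrite (Hc2 i Hi 0); [f_equal; ring| |ring].
  apply lt_succ_iff, nonneg.
Qed.

(** * Discontinuous functionals *)

Definition cont_at_all (Y : M ty2) : Prop :=
  forall f, exists n, forall g, agree f g n -> Y $ f = Y $ g.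

(** Kleene's quantifier over the natural numbers. *)
Definition E2 : Prop := exists E : M ty2, forall f, E $ f = 0 <-> exists n, f $ n = 0.

Lemma agree_le f g n m : agree f g n -> m <= n -> agree f g m.
Proof. intros H K i Hi; apply H, (lt_le_trans Hi K). Qed.

Lemma agree_sym f g n : agree f g n -> agree g f n.
Proof. intros H i Hi; symmetry; auto. Qed.

Lemma agree_trans f g h n : agree f g n -> agree g h n -> agree f h n.
Proof. intros H K i Hi; rewrite H, K; auto. Qed.

(** Grilliot: follow [h], switching to [g $ m] at the least zero [m] of [f]. *)
Lemma seq_discontinuous_E2 (g : M (N0 ~> ty1)) (h : M ty1) (Y : M ty2) :
  (forall k, agree (g $ k) h k) -> (forall k, Y $ (g $ k) <> Y $ h) -> E2.
Proof.
intros Hg HY.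
(* The search includes the argument [i] itself. If it finds no zero it returns [i + 1], and
   [g $ (i + 1)] still agrees with [h] at [i]. *)
pose (u := fun f i => upto (fun j => f $ j <> 0) (i + 1)).
pose (G := lam (fun f => lam (fun i => g $ upto (fun j => f $ j <> 0) (i + 1) $ i))).
assert (GE : forall f i, G $ f $ i = g $ u f i $ i) by (intros; unfold G; betas; reflexivity).
assert (US : forall f i, u f i <= i + 1 /\ (forall j, j < u f i -> f $ j <> 0) /\
  (u f i = i + 1 \/ ~ f $ u f i <> 0)).
{ intros f i; apply upto_spec with (P := fun j => f $ j <> 0); rp. }
exists (lam (fun f => ind (Y $ (G $ f) <> Y $ h))); intros f; rewrite lamE by rp.
rewrite ind_eq0; split.
- intros H; apply NNPP; intros n; apply H; f_equal; apply ext; intros i; rewrite GE.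
  destruct (US f i) as [_ [_ [->|Z]]]; [apply Hg, lt_succ|destruct Z; intros Z; apply n; eauto].
- intros [n Hn].
  destruct (US f n) as [Hm1 [Hm2 Hm3]]; set (m := u f n) in *.
  assert (Hm : f $ m = 0).
  { destruct Hm3 as [Hm3|Hm3]; [|apply NNPP, Hm3].
    destruct (Hm2 n); [rewrite Hm3; apply lt_succ|exact Hn]. }
  replace (G $ f) with (g $ m); [apply HY|]; apply ext; intros i; rewrite GE.
  destruct (US f i) as [_ [H2 H3]]; destruct (lt_total (u f i) m) as [H|[H|H]].
  + destruct H3 as [H3|H3]; [|destruct (H3 (Hm2 _ H))]; rewrite H3 in H |- *.
    rewrite !Hg; auto using lt_succ; apply (lt_trans (lt_succ i) H).
  + rewrite H; reflexivity.
  + destruct (H2 _ H Hm).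
Qed.

(** QF-AC^{0,1} is not available to choose functions witnessing a discontinuity at
    [f].  If the dense sequence [dcd] contains witnesses, numbers are chosen instead;
    if not, [Y] is constant on the part of it near [f], and so [Y] is discontinuous,
    along [dcd], at any witness [g]. *)
Lemma discontinuous_E2 (Y : M ty2) : ~ cont_at_all Y -> E2.
Proof.
intros H.
assert (D : exists f, forall n, exists g, agree f g n /\ Y $ f <> Y $ g).
{ apply NNPP; intros K; apply H; intros f; apply NNPP; intros L; apply K; exists f; intros n.
  apply NNPP; intros J; apply L; exists n; intros g A; apply NNPP; intros I; apply J; eauto. }
destruct D as [f Hf].
destruct (classic (forall n, exists c, agree (dcd $ c) f n /\ Y $ (dcd $ c) <> Y $ f)) as [A|B].
- destruct (choice0 (P := fun n c => agree (dcd $ c) f n /\ Y $ (dcd $ c) <> Y $ f)) as [c Hc];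
    [unfold agree; rp|exact A|].
  apply (@seq_discontinuous_E2 (lam (fun n => dcd $ (c $ n))) f Y); intros k; betas; apply Hc.
- assert (B' : exists n, forall c, agree (dcd $ c) f n -> Y $ (dcd $ c) = Y $ f).
  { apply NNPP; intros K; apply B; intros n; apply NNPP; intros L; apply K; exists n; intros c Hc.
    apply NNPP; intros J; apply L; eauto. }
  destruct B' as [n Hn]; destruct (Hf n) as [g [Hg1 Hg2]].
  destruct (choice0 (P := fun k c => agree (dcd $ c) g (n + k))) as [c Hc].
  { unfold agree; rp. }
  { intros k; destruct (dcd_dense g (n + k)) as [c [_ Hc]]; eauto. }
  apply (@seq_discontinuous_E2 (lam (fun k => dcd $ (c $ k))) g Y); intros k; betas.
  + apply (agree_le (Hc k)), le_addl.
  + rewrite Hn; [exact Hg2|]; apply agree_trans with g; [|apply agree_sym, Hg1].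
    apply (agree_le (Hc k)), le_addr.
Qed.

(** * Sequence codes and WKL inside the model *)

Definition snoc (c a : N) : N := pair c a + 1.

Definition seq_code : M (ty1 ~> ty1) := lam (fun f => lam (fun n =>
  psnd $ (rc $ lam (fun p => pair (pfst $ p + 1) (snoc (psnd $ p) (f $ (pfst $ p)))) $ pair 0 0 $ n))).

Lemma seq_codeE f n : seq_code $ f $ n =
  psnd $ (rc $ lam (fun p => pair (pfst $ p + 1) (snoc (psnd $ p) (f $ (pfst $ p)))) $ pair 0 0 $ n).
Proof. unfold seq_code, snoc, pair; betas; reflexivity. Qed.

Lemma seq_code0 f : seq_code $ f $ 0 = 0.
Proof. rewrite seq_codeE, r0E; apply psndE. Qed.

Lemma seq_codeS f n : seq_code $ f $ (n + 1) = snoc (seq_code $ f $ n) (f $ n).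
Proof.
rewrite !seq_codeE, rSE, lamE by (unfold snoc, pair; rp); rewrite psndE; do 2 f_equal.
nat_induct n; [unfold snoc, pair; rp|rewrite r0E; apply pfstE|].
intros n IH; rewrite rSE, lamE by (unfold snoc, pair; rp); rewrite pfstE, IH; reflexivity.
Qed.

Lemma snoc_inj c a c' a' : snoc c a = snoc c' a' -> c = c' /\ a = a'.
Proof. intros E; apply add_inj, pair_inj in E; exact E. Qed.

Lemma le_seq_code f n : n <= seq_code $ f $ n.
Proof.
nat_induct n; [rp|apply nonneg|]; intros n IH; rewrite seq_codeS.
apply le_add, (le_trans IH), le_pair_l.
Qed.

Lemma seq_code_inj f g n m : seq_code $ f $ n = seq_code $ g $ m -> n = m /\ agree f g n.
Proof.
intros H.
(* The length [m] is at most its code, so it can be bounded, and the induction hypothesis is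
   decidable. *)
assert (I : forall m, m < seq_code $ f $ n + 1 -> seq_code $ f $ n = seq_code $ g $ m ->
  n = m /\ agree f g n).
{ clear m H; nat_induct n; [unfold agree; rp| |].
  - intros m _; rewrite seq_code0; intros E; split; [|intros i Hi; destruct (not_lt0 Hi)].
    destruct (zero_or_succ m) as [->|[k ->]]; [reflexivity|].
    rewrite seq_codeS in E; destruct (succ_neq0 (eq_sym E)).
  - intros n IH m _; rewrite seq_codeS; destruct (zero_or_succ m) as [->|[k ->]].
    { rewrite seq_code0; intros E; destruct (succ_neq0 E). }
    rewrite seq_codeS; intros E; apply snoc_inj in E; destruct E as [E1 E2'].
    destruct (IH k) as [-> A]; [rewrite E1; apply lt_succ_iff, le_seq_code|exact E1|].
    split; [reflexivity|]; intros i Hi; destruct (lt_succ_cases Hi) as [K| ->]; auto. }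
apply I; [rewrite H; apply lt_succ_iff, le_seq_code|exact H].
Qed.

(** The interpretation of [bar_code], up to conversion. *)
Definition sem_code (f : M ty1) (n c : N) : Prop := exists h : M ty1,
  h $ 0 = 0 /\ (forall i, i < n -> h $ (i + 1) = snoc (h $ i) (f $ i)) /\ h $ n = c.

Lemma sem_codeE f n c : sem_code f n c <-> c = seq_code $ f $ n.
Proof.
split.
- intros [h [h0 [hS <-]]].
  assert (I : forall k, k <= n -> h $ k = seq_code $ f $ k); [|apply I, le_refl].
  intros k; nat_induct k; [rp|intros; rewrite seq_code0; exact h0|].
  intros k IH Hk; rewrite seq_codeS, hS, IH; auto.
  + apply (le_trans (lt_le (lt_succ k)) Hk).
  + apply (lt_le_trans (lt_succ k) Hk).
- intros ->; exists (seq_code $ f); split; [apply seq_code0|split; [|reflexivity]].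
  intros i _; apply seq_codeS.
Qed.

Lemma wkl_path (T : M ty1) : models M WKL ->
  (forall c, T $ c = 0 -> exists f, in_C f /\ exists n, c = seq_code $ f $ n) ->
  (forall f, in_C f -> forall n m, m <= n -> T $ (seq_code $ f $ n) = 0 -> T $ (seq_code $ f $ m) = 0) ->
  (forall n, exists c, n < c /\ T $ c = 0) ->
  exists f, in_C f /\ forall n, T $ (seq_code $ f $ n) = 0.
Proof.
intros wkl H1 H2 H3.
assert (K : (forall c, T $ c = 0 -> exists f, in_C f /\ exists n, sem_code f n c) /\
    (forall f, in_C f -> forall n m, m <= n ->
      (exists c, sem_code f n c /\ T $ c = 0) -> exists c, sem_code f m c /\ T $ c = 0) ->
  (forall n, exists c, n < c /\ T $ c = 0) ->
  exists f, in_C f /\ forall n, exists c, sem_code f n c /\ T $ c = 0)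
  by exact (wkl nil _ (enil M) (Defs.wkl nil) T).
destruct K as [f [Cf Hf]].
- split.
  + intros c Hc; destruct (H1 c Hc) as [f [Cf [n Hn]]]; exists f; split; [exact Cf|].
    exists n; apply sem_codeE, Hn.
  + intros f Cf n m mn [c [Hc1 Hc2]]; exists (seq_code $ f $ m).
    split; [apply sem_codeE; reflexivity|].
    apply sem_codeE in Hc1; subst c; exact (H2 f Cf n m mn Hc2).
- exact H3.
- exists f; split; [exact Cf|]; intros n; destruct (Hf n) as [c [Hc1 Hc2]].
  apply sem_codeE in Hc1; subst c; exact Hc2.
Qed.

(** * The equivalence *)

Definition is_kappa (k : M ty3) : Prop :=
  forall Y, k $ Y = 0 <-> exists f, in_C f /\ 0 < Y $ f.

Definition is_Z (Z : M ty3) : Prop := forall Y, Z $ Y = 0 <-> cont_at_all Y.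

Definition uniform_on_C (Y : M ty2) (n : N) : Prop :=
  forall f, in_C f -> forall g, in_C g -> agree f g n -> Y $ f = Y $ g.

Definition is_fan (Phi : M ty3) : Prop :=
  forall Y, cont_at_all Y -> uniform_on_C Y (Phi $ Y).

Definition C_quant : Prop := forall G (P : env G -> M ty1 -> Prop),
  dec (fun e : env (ty1 :: G) => P (snd e) (fst e)) ->
  dec (fun e => exists f, in_C f /\ P e f).

Lemma pos_neq0 (x : N) : 0 < x <-> x <> 0.
Proof.
split; [intros H ->; exact (lt_irr H)|]; intros H; destruct (nonneg x) as [|E]; [assumption|].
destruct (H (eq_sym E)).
Qed.

Lemma kappa_C_quant k : is_kappa k -> C_quant.
Proof.
(* Since [ind] is 0 on true propositions, the negation makes the functional positive exactly where
   [P] holds. *)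
intros Hk G P hP; apply dec_ext with (fun e => k $ lam (fun f => ind (~ P e f)) = 0).
- intros e; rewrite (Hk _).
  assert (E : forall f, 0 < lam (fun f => ind (~ P e f)) $ f <-> P e f).
  { intros f; rewrite lamE by exact (rep_at e (dec_not hP)).
    rewrite pos_neq0, ind_eq0; tauto. }
  split; intros [f [C H]]; exists f; split; auto; apply E, H.
- rp.
Qed.

Lemma dec_all_C : C_quant -> forall G (P : env G -> M ty1 -> Prop),
  dec (fun e : env (ty1 :: G) => P (snd e) (fst e)) ->
  dec (fun e => forall f, in_C f -> P e f).
Proof.
intros Q G P hP; apply dec_ext with (fun e => ~ exists f, in_C f /\ ~ P e f); [|apply dec_not, Q; rp].
intros e; split; [|firstorder]; intros H f C; apply NNPP; intros K; apply H; eauto.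
Qed.

Ltac rp_extra ::=
  match goal with
  | |- dec (fun e => exists f, in_C f /\ @?P e f) =>
      match goal with H : C_quant |- _ => apply H; rp end
  | |- dec (fun e => forall f, in_C f -> @?P e f) =>
      match goal with H : C_quant |- _ => apply (dec_all_C H); rp end
  end.

(** If no modulus works, the binary sequences with two extensions in Cantor space on which [Y]
    differs form an infinite tree, and a path through it contradicts continuity there. [C_quant] is
    what makes this tree an object of the model. *)
Lemma cont_uniform (Y : M ty2) : models M WKL -> C_quant -> cont_at_all Y ->
  exists n, uniform_on_C Y n.
Proof.
intros wkl Q HY; apply NNPP; intros H.
pose (split_at := fun f n => exists g, in_C g /\ exists h, in_C h /\
  (agree g f n /\ agree h f n /\ Y $ g <> Y $ h)).
pose (T := lam (fun c => ind (exists f, in_C f /\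
  exists n, n < c + 1 /\ (c = seq_code $ f $ n /\ split_at f n)))).
assert (mono : forall f g n m, agree f g m -> m <= n -> split_at f n -> split_at g m).
{ intros f g n m A mn [p [Cp [q [Cq [A1 [A2 A3]]]]]].
  exists p; split; [exact Cp|]; exists q; split; [exact Cq|].
  split; [|split]; [| |exact A3]; (eapply agree_trans; [|exact A]); eapply agree_le; eauto. }
assert (TE : forall f n, in_C f -> T $ (seq_code $ f $ n) = 0 <-> split_at f n).
{ intros f n C; unfold T; rewrite lamE by (unfold split_at, agree; rp); rewrite ind_eq0; split.
  - intros [g [Cg [m [_ [E S]]]]]; apply seq_code_inj in E; destruct E as [<- A].
    apply mono with g n; auto using le_refl, agree_sym.
  - intros S; exists f; split; [exact C|]; exists n; split; [apply lt_succ_iff, le_seq_code|auto]. }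
destruct (@wkl_path T wkl) as [f [Cf Hf]].
- intros c; unfold T; rewrite lamE by (unfold split_at, agree; rp); rewrite ind_eq0.
  intros [f [C [n [_ [E _]]]]]; eauto.
- intros f C n m mn; rewrite !TE by assumption.
  apply mono; auto; intros i _; reflexivity.
- intros n.
  (* Length [n + 1] makes the code exceed [n], as infinity of the tree demands. *)
  assert (D : exists f, in_C f /\ split_at f (n + 1)).
  { apply NNPP; intros K; apply H; exists (n + 1); intros f Cf g Cg A.
    apply NNPP; intros L; apply K; exists f; split; [exact Cf|].
    exists f; split; [exact Cf|]; exists g; split; [exact Cg|].
    split; [intros i _; reflexivity|split; [apply agree_sym, A|exact L]]. }
  destruct D as [f [C D]]; exists (seq_code $ f $ (n + 1)); split; [|apply TE; auto].
  apply (lt_le_trans (lt_succ n)), le_seq_code.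
- destruct (HY f) as [n Hn].
  destruct (proj1 (TE f n Cf) (Hf n)) as [g [_ [h [_ [A1 [A2 A3]]]]]]; apply A3.
  rewrite <- (Hn g), <- (Hn h); auto using agree_sym.
Qed.

(** [Z] replaces the premise of continuity by an equation, so the matrix is decidable and the choice
    total, with value 0 at discontinuous [Y]. *)
Lemma fan_of_kappa_Z k Z : models M WKL -> models M (QF_AC ty2 N0) ->
  is_kappa k -> is_Z Z -> exists Phi, is_fan Phi.
Proof.
intros wkl ac Hk HZ; assert (Q := kappa_C_quant Hk).
destruct (@choice_of_qf ty2 ac (fun Y n => Z $ Y = 0 -> uniform_on_C Y n)) as [Phi HPhi].
- unfold uniform_on_C, agree; rp.
- intros Y; destruct (classic (Z $ Y = 0)) as [H|H]; [|exists 0; tauto].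
  destruct (cont_uniform wkl Q (proj1 (HZ Y) H)) as [n Hn]; eauto.
- exists Phi; intros Y HY; apply HPhi, HZ, HY.
Qed.

Definition nat_quant : Prop := forall G (P : env G -> N -> Prop),
  dec (fun e : env (N0 :: G) => P (snd e) (fst e)) -> dec (fun e => exists n, P e n).

Definition fun_quant : Prop := forall G (P : env G -> M ty1 -> Prop),
  dec (fun e : env (ty1 :: G) => P (snd e) (fst e)) -> dec (fun e => exists f, P e f).

Lemma E2_nat_quant : E2 -> nat_quant.
Proof.
intros [E HE] G P hP; apply dec_ext with (fun e => E $ lam (fun n => ind (P e n)) = 0); [|rp].
intros e; rewrite HE.
assert (A : forall n, lam (fun n => ind (P e n)) $ n = 0 <-> P e n).
{ intros n; rewrite lamE by exact (rep_at e hP); apply ind_eq0. }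
split; intros [n Hn]; exists n; apply A, Hn.
Qed.

(** A function is read off from the characteristic function of its graph, so that
    quantifying over Baire space reduces to quantifying over Cantor space. *)
Lemma E2_fun_quant : E2 -> C_quant -> fun_quant.
Proof.
intros HE Q; assert (NQ := E2_nat_quant HE); destruct HE as [E HE].
(* Feferman's search operator: it returns a zero of [f] whenever there is one. *)
destruct (choice1 (P := fun f n => E $ f = 0 -> f $ n = 0)) as [mu Hmu]; [rp| |].
{ intros f; destruct (classic (E $ f = 0)) as [H|H]; [|exists 0; tauto].
  destruct (proj1 (HE f) H) as [n Hn]; exists n; auto. }
(* If [h] describes a graph, [D $ h] is its function. Other [h] give some function too, which is
   harmless: only surjectivity from Cantor space matters. *)
pose (D := lam (fun h : M ty1 => lam (fun n => mu $ lam (fun m => h $ pair n m)))).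
assert (DE : forall h n, D $ h $ n = mu $ lam (fun m => h $ pair n m)).
{ intros h n; unfold D, pair; betas; reflexivity. }
assert (surj : forall f, exists h, in_C h /\ D $ h = f).
{ intros f; exists (lam (fun p => ind (psnd $ p = f $ (pfst $ p)))); split.
  - apply in_CE; intros p; rewrite lamE by rp; unfold ind.
    destruct (classic (psnd $ p = f $ (pfst $ p)));
      [rewrite ite_true by assumption; apply nonneg|rewrite ite_false by assumption; apply le_refl].
  - apply ext; intros n; rewrite DE; set (h := lam (fun m => _)).
    assert (hE : forall m, h $ m = 0 <-> m = f $ n).
    { intros m; unfold h; rewrite lamE by (unfold pair; rp); rewrite lamE by rp.
      rewrite ind_eq0, pfstE, psndE; tauto. }
    apply hE, Hmu, HE; exists (f $ n); apply hE; reflexivity. }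
intros G P hP.
apply dec_ext with (fun e => exists h, in_C h /\ P e (D $ h)).
- intros e; split; [intros [h [_ H]]; eauto|]; intros [f H]; destruct (surj f) as [h [C <-]]; eauto.
- apply Q; destruct (hP) as [m Hm].
  apply rep_ext with (fun e : env (ty1 :: G) => @apn G (snd e) (ty1 ~> N0) m $ (D $ fst e)).
  + intros e; exact (Hm (D $ fst e, snd e)).
  + apply rep_app; [|rp].
    apply (rep_snd ty1 (F := fun e : env G => @apn G e (ty1 ~> N0) m)); exists m; reflexivity.
Qed.

Lemma dec_all_of_ex s : (forall G (P : env G -> M s -> Prop),
    dec (fun e : env (s :: G) => P (snd e) (fst e)) -> dec (fun e => exists f, P e f)) ->
  forall G (P : env G -> M s -> Prop),
    dec (fun e : env (s :: G) => P (snd e) (fst e)) -> dec (fun e => forall f, P e f).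
Proof.
intros Q G P hP; apply dec_ext with (fun e => ~ exists f, ~ P e f).
- intros e; split; [|firstorder]; intros H f; apply NNPP; intros K; apply H; eauto.
- apply dec_not, Q, dec_not, hP.
Qed.

Lemma Z_of_kappa k : is_kappa k -> exists Z, is_Z Z.
Proof.
intros Hk; assert (Q := kappa_C_quant Hk); destruct (classic E2) as [HE|HE].
- assert (NQ := E2_nat_quant HE); assert (FQ := E2_fun_quant HE Q).
  assert (R : rep (fun e : env [ty2] => ind (cont_at_all (fst e)))).
  { unfold cont_at_all; apply rep_ind, (dec_all_of_ex FQ), NQ, (dec_all_of_ex FQ); unfold agree; rp. }
  exists (lam (fun Y => ind (cont_at_all Y))); intros Y; rewrite lamE by exact R; apply ind_eq0.
- exists (kc $ 0); intros Y; rewrite kE; split; [intros _|reflexivity].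
  apply NNPP; intros n; exact (HE (discontinuous_E2 n)).
Qed.

(** A retraction onto Cantor space: 0 and 2 go to 0, while 1 and 3 go to 1, so a binary value
    survives the addition of 2. *)
Definition clip (f : M ty1) : M ty1 := lam (fun i => ite (f $ i = 0 \/ f $ i = 1 + 1) 0 1).

Lemma clipE f i : clip f $ i = ite (f $ i = 0 \/ f $ i = 1 + 1) 0 1.
Proof. unfold clip; betas; reflexivity. Qed.

Lemma clip_in_C f : in_C (clip f).
Proof.
apply in_CE; intros i; rewrite clipE; destruct (classic (f $ i = 0 \/ f $ i = 1 + 1));
  [rewrite ite_true by assumption; apply nonneg|rewrite ite_false by assumption; apply le_refl].
Qed.

Lemma one_neq_two : (1 : N) <> 1 + 1.
Proof. intros H; apply (lt_irr (x := 1)); rewrite H at 2; apply lt_succ. Qed.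

Lemma clip_value f g i : in_C f -> g $ i = f $ i \/ g $ i = f $ i + (1 + 1) -> clip g $ i = f $ i.
Proof.
intros C H; rewrite clipE.
destruct (le1_cases (proj1 (in_CE f) C i)) as [F|F]; rewrite F in *.
- apply ite_true; destruct H as [->| ->]; [left|right]; ring.
- apply ite_false; intros K; destruct H as [H|H]; rewrite H in K; destruct K as [K|K].
  + exact (zero_neq_one (eq_sym K)).
  + exact (one_neq_two K).
  + replace (1 + (1 + 1)) with ((1 + 1 : N) + 1) in K by ring; exact (succ_neq0 K).
  + replace (1 + (1 + 1)) with ((1 + 1 : N) + 1) in K by ring.
    apply (lt_irr (x := 1 + 1)); rewrite <- K at 2; apply lt_succ.
Qed.

(** The functional [g |-> Y (clip g)] if [g] takes a value above 1, else [0], is constant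
    if [Y] vanishes on Cantor space, and discontinuous at every [f] of Cantor space with
    [Y f > 0], since adding 2 to a value of [f] far out does not change [clip f]. *)
Lemma kappa_of_Z_E2 Z : E2 -> is_Z Z -> exists k, is_kappa k.
Proof.
intros HE HZ; assert (NQ := E2_nat_quant HE).
pose (W := fun Y : M ty2 => lam (fun g => ite (exists n, 1 < g $ n) (Y $ clip g) 0)).
assert (RW : forall G (Y : env G -> M ty2) (g : env G -> M ty1), rep Y -> rep g ->
  rep (fun e => ite (exists n, 1 < g e $ n) (Y e $ clip (g e)) 0)).
{ intros G Y g hY hg; apply rep_ite; [apply NQ| |apply rep_const].
  - apply dec_lt; [apply rep_const|]; apply rep_app; [apply rep_snd, hg|apply rep_fst].
  - apply rep_app; [exact hY|]; unfold clip; apply rep_lam.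
    assert (hg' : rep (fun e : env (N0 :: G) => g (snd e) $ fst e))
      by (apply rep_app; [apply rep_snd, hg|apply rep_fst]).
    apply rep_ite; [apply dec_or; apply dec_eq| |]; first [exact hg'|apply rep_const]. }
assert (WE : forall Y g, W Y $ g = ite (exists n, 1 < g $ n) (Y $ clip g) 0).
{ intros Y g; unfold W; rewrite lamE; [reflexivity|]; apply RW; rp. }
exists (lam (fun Y => ind (~ Z $ W Y = 0))); intros Y.
rewrite lamE; [rewrite ind_eq0, (HZ _)|].
2:{ apply rep_ind, dec_not, dec_eq; [|apply rep_const]; apply rep_app; [apply rep_const|].
    apply rep_lam, RW; rp. }
split.
- intros H; apply NNPP; intros K; apply H; intros f; exists 0; intros g _; rewrite !WE.
  assert (Z0 : forall h, Y $ clip h = 0).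
  { intros h; apply NNPP; intros L; apply K; exists (clip h); split; [apply clip_in_C|].
    apply pos_neq0, L. }
  rewrite !Z0; unfold ite; destruct (excluded_middle_informative _), (excluded_middle_informative _); reflexivity.
- intros [f [C H]] K; destruct (K f) as [n Hn].
  pose (g := lam (fun i => ite (i = n) (f $ i + (1 + 1)) (f $ i))).
  assert (gE : forall i, g $ i = ite (i = n) (f $ i + (1 + 1)) (f $ i))
    by (intros i; unfold g; betas; reflexivity).
  assert (A : agree f g n).
  { intros i Hi; rewrite gE, ite_false; [reflexivity|]; intros ->; exact (lt_irr Hi). }
  specialize (Hn g A); revert Hn; rewrite !WE, ite_false, ite_true.
  + replace (clip g) with f; [intros E; rewrite <- E in H; exact (lt_irr H)|].
    apply ext; intros i; symmetry; apply clip_value; [exact C|]; rewrite gE.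
    destruct (classic (i = n)); [right; apply ite_true|left; apply ite_false]; assumption.
  + exists n; rewrite gE, ite_true by reflexivity.
    replace (f $ n + (1 + 1)) with (f $ n + 1 + 1) by ring.
    apply lt_succ_iff, le_addl.
  + intros [m Hm]; exact (le_not_lt (proj1 (in_CE f) C m) Hm).
Qed.

Lemma kappa_of_fan Phi : ~ E2 -> is_fan Phi -> exists k, is_kappa k.
Proof.
intros HE HPhi.
assert (R : rep (fun e : env [ty2] =>
  ind (exists c, c < cbound (Phi $ fst e) + 1 /\ 0 < fst e $ clip (dcd $ c)))).
{ unfold cbound, clip; rp. }
exists (lam (fun Y => ind (exists c, c < cbound (Phi $ Y) + 1 /\ 0 < Y $ clip (dcd $ c)))).
intros Y; rewrite lamE by exact R; rewrite ind_eq0; split.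
- intros [c [_ H]]; exists (clip (dcd $ c)); split; [apply clip_in_C|exact H].
- intros [f [C H]]; destruct (dcd_dense f (Phi $ Y)) as [c [B A]].
  exists c; split; [apply lt_succ_iff, B, C|].
  (* [clip] moves [dcd $ c] into Cantor space and preserves the binary values that it shares with
     [f] below the modulus. *)
  replace (Y $ clip (dcd $ c)) with (Y $ f); [exact H|].
  apply HPhi; auto using clip_in_C.
  + apply NNPP; intros n; exact (HE (discontinuous_E2 n)).
  + intros i Hi; symmetry; apply clip_value; auto.
Qed.

Lemma kappa_iff_Z_fan : models M WKL -> models M (QF_AC ty2 N0) ->
  ((exists k, is_kappa k) <-> (exists Z, is_Z Z) /\ (exists Phi, is_fan Phi)).
Proof.
intros wkl ac; split.
- intros [k Hk]; destruct (Z_of_kappa Hk) as [Z HZ]; split; [eauto|].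
  exact (fan_of_kappa_Z wkl ac Hk HZ).
- intros [[Z HZ] [Phi HPhi]]; destruct (classic E2) as [HE|HE].
  + exact (kappa_of_Z_E2 HE HZ).
  + exact (kappa_of_fan HE HPhi).
Qed.

End BaseTheory.

Local Open Scope ho_scope.

Theorem theorem3p1 :
  WKL0w [U] QF_AC ty2 N0 |-- kappa03 <==> (Z3 [&] FF).
Proof.
apply completeness.
- repeat apply subst_closed_union; auto using subst_closed_RCA0w, subst_closed_WKL, subst_closed_QF_AC.
- intros G B a; left; left; exact a.
- intros M ext hM.
  assert (base : models M RCA0w) by (intros G A rho a; apply hM; left; left; exact a).
  assert (wkl : models M WKL) by (intros G A rho a; apply hM; left; right; exact a).
  assert (ac : models M (QF_AC ty2 N0)) by (intros G A rho a; apply hM; right; exact a).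
  (* The semantic definitions mirror the formulas, so satisfaction of the goal unfolds to this
     statement by conversion. *)
  exact (kappa_iff_Z_fan ext base wkl ac).
Qed.
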